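(* Let $G=(V,E,J)$ be a connected transitive weighted graph, let $o$ be a vertex of $G$, and let $\Gamma \subseteq \mathrm{Aut}(G)$ be a closed, transitive, unimodular subgroup of automorphisms of $G$. Let $\mu$ be a $\Gamma$-invariant probability measure on $[0,1]^E$ and suppose that there exist constants $A<\infty$ and $0\leq \theta <1/2$ such that $\mathbf{P}_{\mu}(|K_o| \geq n) \leq A n^{-\theta}$ for every $n \geq 1$. Then \[ \sum_{e\in E^\rightarrow_o} \mathbf{E}_{\mu}\left[\mathbb{1}(\mathscr{S}_{e,n}') \sqrt{\frac{\mathbf{p}_e}{1-\mathbf{p}_e}}\right]^2 \leq \frac{40000 \cdot A^2}{(1-2\theta)^2 n^{1+2\theta}} \qquad \text{ for every } n\geq 1. \]
   Context: A weighted graph $G=(V,E,J)$ is a countable graph $(V,E)$ together with positive weights $\{J_e:e\in E\}$ such that $\sum_{e\in E^\rightarrow_v}J_e<\infty$ for each $v\in V$, where $E^\rightarrow_v$ is the set of oriented edges emanating from $v$; functions of unoriented edges are applied to oriented edges by forgetting the orientation. $\mathrm{Aut}(G)$ is the group of weight-preserving graph automorphisms (with the topology of pointwise convergence), and $G$, or a subgroup $\Gamma\subseteq\mathrm{Aut}(G)$, is transitive if $\mathrm{Aut}(G)$, respectively $\Gamma$, acts transitively on $V$. A closed transitive subgroup $\Gamma$ is unimodular if $\sum_{v\in V}F(o,v)=\sum_{v\in V}F(v,o)$ for every $o\in V$ and every $F:V^2\to[0,\infty]$ with $F(\gamma u,\gamma v)=F(u,v)$ for all $u,v\in V$, $\gamma\in\Gamma$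 (the mass-transport principle). Percolation in random environment: given a probability measure $\mu$ on $[0,1]^E$, let $\mathbf{p}=(\mathbf{p}_e)_{e\in E}$ have law $\mu$, let $(U_e)_{e\in E}$ be i.i.d. Uniform$[0,1]$ independent of $\mathbf{p}$, and let $\omega(e)=\mathbb{1}(U_e\le\mathbf{p}_e)$. $\mathbf{P}_\mu$ (with expectation $\mathbf{E}_\mu$) is the joint law of $\mathbf{p}$ and $\omega$. Edges with $\omega(e)=1$ are open, the others closed; clusters are the connected components of the subgraph of open edges, and $K_o$ is the cluster of $o$, with $|K_o|$ its number of vertices. $\mathscr{S}'_{e,n}$ is the event that the endpoints of $e$ belong to distinct clusters, each of which includes at least $n$ vertices and at least one of which is finite. (On this event $e$ is closed, so $\mathbf{p}_e<1$ almost surely; the integrand is taken to be $0$ off the event.) *)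

(* Defs.v *)
From HB Require Import structures.
From Stdlib Require Export Relation_Operators.
From mathcomp Require Export all_boot all_order all_algebra.
From mathcomp Require Export all_classical all_reals all_analysis.

Set Implicit Arguments.
Unset Strict Implicit.
Unset Printing Implicit Defensive.

Import Order.TTheory GRing.Theory Num.Theory.
Import numFieldNormedType.Exports.

Local Open Scope classical_set_scope.
Local Open Scope ring_scope.

(* Loops and parallel edges are allowed.  [ends e] lists the endpoints of the
   unoriented edge [e] in an arbitrary order; the two orientations of [e] are
   the pairs [(e, true)] and [(e, false)]. *)
Definition endpoint (V E : Type) (ends : E -> V * V) (a : E * bool) : V :=
  if a.2 then (ends a.1).1 else (ends a.1).2.

Record weighted_graph (R : realType) := WeightedGraph {
  vertex : countType;
  edge : countType;
  ends : edge -> vertex * vertex;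
  weight : edge -> R;
  weight_gt0 : forall e, 0 < weight e;
  weight_summable : forall v,
    (\esum_(a in [set a : edge * bool | endpoint ends a = v])
       (weight a.1)%:E < +oo)%E
}.

Section Graph.
Variables (R : realType) (G : weighted_graph R).

Definition oriented_edges_from (v : vertex G) : set (edge G * bool) :=
  [set a | endpoint (@ends R G) a = v].

Definition joins (e : edge G) (u v : vertex G) : Prop :=
  ends e = (u, v) \/ ends e = (v, u).

Definition cluster (S : set (edge G)) (v : vertex G) : set (vertex G) :=
  [set u | clos_refl_trans _ (fun x y => exists2 e, S e & joins e x y) v u].

Definition graph_connected : Prop := forall u v : vertex G, cluster setT u v.

(* For automorphisms the two components are the actions on vertices and on
   edges.  The type carries the topology of pointwise convergence. *)
Definition graph_map : topologicalType :=
  ({ptws vertex G -> discrete_topology (vertex G)} *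
   {ptws edge G -> discrete_topology (edge G)})%type.

Definition on_vertex (g : graph_map) : vertex G -> vertex G := g.1.
Definition on_edge (g : graph_map) : edge G -> edge G := g.2.

Definition map_id : graph_map := (id, id).
Definition map_comp (g h : graph_map) : graph_map :=
  (on_vertex g \o on_vertex h, on_edge g \o on_edge h).

Definition Aut : set graph_map :=
  [set g | [/\ bijective (on_vertex g), bijective (on_edge g),
    forall e u v, joins e u v ->
      joins (on_edge g e) (on_vertex g u) (on_vertex g v) &
    forall e, weight (on_edge g e) = weight e]].

Definition subgroup_of_Aut (Gamma : set graph_map) : Prop :=
  [/\ Gamma `<=` Aut, Gamma map_id,
    forall g h, Gamma g -> Gamma h -> Gamma (map_comp g h) &
    forall g, Gamma g -> exists h,
      [/\ Gamma h, map_comp g h = map_id & map_comp h g = map_id]].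

(* Closed relative to [Aut]. *)
Definition closed_in_Aut (Gamma : set graph_map) : Prop :=
  closure Gamma `&` Aut `<=` Gamma.

Definition acts_transitively (Gamma : set graph_map) : Prop :=
  forall u v : vertex G, exists2 g, Gamma g & on_vertex g u = v.

Definition unimodular (Gamma : set graph_map) : Prop :=
  forall (o : vertex G) (F : vertex G -> vertex G -> \bar R),
    (forall u v, 0 <= F u v)%E ->
    (forall g, Gamma g ->
       forall u v, F (on_vertex g u) (on_vertex g v) = F u v) ->
    (\esum_(v in [set: vertex G]) F o v =
     \esum_(v in [set: vertex G]) F v o)%E.

(* The endpoints of [e] lie in distinct clusters, each with at least [n]
   vertices and at least one of them finite. *)
Definition two_clusters (e : edge G) (n : nat) (S : set (edge G)) : Prop :=
  let K := cluster S (ends e).1 in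
  let K' := cluster S (ends e).2 in
  [/\ K <> K', (`I_n #<= K)%card, (`I_n #<= K')%card &
      finite_set K \/ finite_set K'].

End Graph.

Section ProductSpace.
Variables (I : Type) (d : measure_display) (T : measurableType d).

Definition cylinders : set (set (I -> T)) :=
  [set C | exists i (B : set T), measurable B /\ C = [set f | B (f i)]].

Definition product_space := g_sigma_algebraType cylinders.

End ProductSpace.

Section UnitInterval.
Variable R : realType.

(* [0, 1] with the trace of the Borel sigma-algebra of the line. *)
HB.instance Definition _ := isPointed.Build {i01 R} (0%:i01).

Definition unit_interval :=
  g_sigma_algebra_preimageType (fun x : {i01 R} => x%:num : R).

End UnitInterval.

Section Independence.
Context d (Om : measurableType d) (R : realType) (P : probability Om R).
Local Open Scope ereal_scope.

Definition independent d1 (T1 : measurableType d1) d2 (T2 : measurableType d2)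
    (X : Om -> T1) (Y : Om -> T2) : Prop :=
  forall A B, measurable A -> measurable B ->
    P (X @^-1` A `&` Y @^-1` B) = P (X @^-1` A) * P (Y @^-1` B).

Definition mutually_independent (I : choiceType) d' (T : measurableType d')
    (X : I -> Om -> T) : Prop :=
  forall (s : seq I) (B : I -> set T), uniq s -> (forall i, measurable (B i)) ->
    P (\bigcap_(i in [set` s]) (X i @^-1` B i)) =
    \prod_(i <- s) P (X i @^-1` B i).

End Independence.

Section Percolation.
Variables (R : realType) (G : weighted_graph R).

Definition environment := product_space (edge G) (unit_interval R).

Definition invariant_law (Gamma : set (graph_map G))
    (mu : probability environment R) : Prop :=
  forall g, Gamma g -> forall A : set environment, measurable A ->
    mu [set q : environment | A (fun e => q (on_edge g e))] = mu A.

Context d (Om : measurableType d) (P : probability Om R).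
Variables (p : {RV P >-> environment}) (U : edge G -> {RV P >-> R}).

Definition env_at (x : Om) (e : edge G) : R := (p x e : {i01 R})%:num.

(* A space [(Om, P)] carrying [p] of law [mu] and i.i.d. uniform labels
   independent of [p]; [P_mu] is the joint law of [p] and [open_edges]. *)
Definition percolation_in_environment (mu : probability environment R) : Prop :=
  [/\ forall A : set environment, measurable A -> distribution P p A = mu A,
      forall e (B : set R), measurable B ->
        distribution P (U e) B = uniform_prob (@ltr01 R) B,
      mutually_independent P U &
      independent P p
        (fun x => (fun e => U e x) : product_space (edge G) R)].

Definition open_edges (x : Om) : set (edge G) :=
  [set e | U e x <= env_at x e].

Definition cluster_ge (v : vertex G) (n : nat) : set Om :=
  [set x | (`I_n #<= cluster (open_edges x) v)%card].

Definition two_clusters_event (e : edge G) (n : nat) : set Om :=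
  [set x | two_clusters e n (open_edges x)].

(* Division by zero yields 0 in the library, so the integrand is 0 at
   [env_at x e = 1]; inside the event this happens with probability 0. *)
Definition sqrt_odds_on_event (e : edge G) (n : nat) (x : Om) : R :=
  \1_(two_clusters_event e n) x *
  Num.sqrt (env_at x e / (1 - env_at x e)).

End Percolation.

(* Main.v *)
Require Import Defs.
From HB Require Import structures.
From mathcomp Require Import all_boot all_order all_algebra.
From mathcomp Require Import finmap.
From mathcomp Require Import all_classical all_reals all_analysis.
From mathcomp Require Import measurable_realfun ring lra zify.

Import Order.TTheory GRing.Theory Num.Theory.
Import numFieldNormedType.Exports.
Local Open Scope classical_set_scope.
Local Open Scope ring_scope.

Set Implicit Arguments.
Unset Strict Implicit.
Unset Printing Implicit Defensive.

(* Give a cluster of size [k] the weight [f k = min (k / n) 1], cut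
   off above a level [L], and let [N e] be the total weight of the distinct
   clusters at [e].  Since [f] is subadditive, opening [e] decreases [N e], and by
   at least 1 if [e] separates two clusters of size at least [n], one of them of
   size at most [L].  Let [X e] be [sqrt (p / (1 - p))] if [e] is closed and
   [- sqrt ((1 - p) / p)] if it is open; given the environment it has mean 0 and
   variance at most 1.  Resampling [e] bounds the expectation in the theorem by
   [gain e := E (X e * N e)], up to the cut-off.

   For an invariant weight [w <= gain], mass transport turns
   [sum_(e at o) w e * gain e] into [2 E (f k / k * Z)], where [k] is the size of
   the cluster of [o] and [Z] the sum of [w e * X e] over the edges touching it.
   Exploring the cluster edge by edge makes [Z] the end value of a martingale, so
   that [E (g k * Z ^ 2) <= W2 * sum_c g c * P (k >= c)] for nonincreasing [g],
   with [W2 = sum_(e at o) w e ^ 2].  Cauchy-Schwarz and the tail assumption then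
   bound [W2 <= sum_(e at o) w e * gain e] by a multiple of [sqrt W2]. *)

(* MathComp-Analysis uses the name [cluster] for cluster points of a filter. *)
Local Notation cluster := Defs.cluster.

(** * Independent Bernoulli edges *)

(** Only finite configurations are ever explored. Each inequality is proved for the edges below a
    level [N], where fixing the environment leaves a finite product measure. Then [N] grows, then
    finite sets of edges exhaust the sum, and [L] grows last. The cut-off at [L] makes the first
    limit harmless: the finite pieces of an infinite cluster eventually have more than [L] vertices
    and so weight 0, the same weight as the infinite cluster. Mass transport and Tonelli need
    nonnegative terms, so [X e] never appears as a signed integrand over the whole graph: its
    positive and negative parts are carried separately, and each signed bound is written as an
    inequality with a sum of negative parts added on one side. Cauchy-Schwarz is used in its linear
    form [f * y <= l / 2 * (a * y ^+ 2) + b / (2 * l)], which survives finite averages and limits.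
    It leads to [W2 <= l * W2 * alpha + beta / l], where [alpha] and [beta] are the tail sums of two
    dual weights. Taking [l] of order [1 / alpha] absorbs half of the left side, which requires [W2]
    to be finite. *)

Section BernoulliExpectation.
Variables (R : realType) (E : choiceType).
Implicit Types (q : E -> R) (s : seq E) (f h : set E -> R) (S : set E).

(** Expectation under independent edges of parameters [q], written as nested averages so that
    revealing an edge is one unfolding; edges outside [s] are closed. *)
Fixpoint bexp q s f : R :=
  if s is e :: s' then
    q e * bexp q s' (fun S => f (e |` S)) + (1 - q e) * bexp q s' f
  else f set0.

Lemma bexp_le q s f h : (forall e, 0 <= q e <= 1) ->
  (forall S, S `<=` [set` s] -> f S <= h S) -> bexp q s f <= bexp q s h.
Proof.
move=> q01; elim: s f h => [|e s IH] f h fh /=; first exact: fh.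
have /andP[q0 q1] := q01 e.
apply: lerD; apply: ler_wpM2l; rewrite ?subr_ge0 //; apply: IH => S Ss.
  apply: fh => x [->|/Ss /= xs] /=; rewrite in_cons ?eqxx// ?xs ?orbT//.
by apply: fh => x /Ss /= xs /=; rewrite in_cons xs orbT.
Qed.

Lemma eq_bexp q s f h : (forall S, S `<=` [set` s] -> f S = h S) ->
  bexp q s f = bexp q s h.
Proof.
elim: s f h => [|e s IH] f h fh /=; first exact: fh.
congr (_ * _ + _ * _); apply: IH => S Ss; apply: fh => x.
  by move=> [->|/Ss /= xs] /=; rewrite in_cons ?eqxx// ?xs ?orbT.
by move=> /Ss /= xs /=; rewrite in_cons xs orbT.
Qed.

Lemma bexp_cst q s c : bexp q s (fun=> c) = c.
Proof. by elim: s => [//|e s IH] /=; rewrite IH; ring. Qed.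

Lemma bexpD q s f h : bexp q s (fun S => f S + h S) = bexp q s f + bexp q s h.
Proof. by elim: s f h => [//|e s IH] f h /=; rewrite !IH; ring. Qed.

Lemma bexpZ q s c f : bexp q s (fun S => c * f S) = c * bexp q s f.
Proof. by elim: s f => [//|e s IH] f /=; rewrite !IH; ring. Qed.

Lemma bexp_sum (I : Type) (r : seq I) q s (F : I -> set E -> R) :
  bexp q s (fun S => \sum_(i <- r) F i S) = \sum_(i <- r) bexp q s (F i).
Proof.
elim: r => [|i r IH].
  by rewrite big_nil -[RHS](bexp_cst q s); apply: eq_bexp => S _; rewrite big_nil.
rewrite big_cons -IH -bexpD; apply: eq_bexp => S _; by rewrite big_cons.
Qed.

Lemma bexp_ge0 q s f : (forall e, 0 <= q e <= 1) ->
  (forall S, 0 <= f S) -> 0 <= bexp q s f.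
Proof. by move=> q01 f0; rewrite -(bexp_cst q s 0); apply: bexp_le. Qed.

(** Averages over different edges commute, so any edge may be revealed first. This lets the
    exploration choose its next edge according to what it has seen. *)
Lemma bexp_rem q s e f : e \in s -> bexp q s f =
  q e * bexp q (rem e s) (fun S => f (e |` S)) + (1 - q e) * bexp q (rem e s) f.
Proof.
elim: s f => [//|a s IH] f /=; rewrite in_cons eq_sym.
have [-> //|_ /= es] := eqVneq a e; rewrite !IH//.
under [X in _ * (_ * X + _)]eq_bexp => S _ do rewrite setUCA.
ring.
Qed.

End BernoulliExpectation.

(** * Normalised edge increments *)

Section Odds.
Variable R : realType.

(* The normalised increment attached to an edge of parameter [q] that is open
   iff [b] has mean 0 and variance at most 1; [odds true] and [odds false] are
   its positive and negative parts. *)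
Definition odds (sg b : bool) (q : R) : R :=
  if sg == b then 0
  else if b then Num.sqrt ((1 - q) / q) else Num.sqrt (q / (1 - q)).

Lemma odds_ge0 sg b q : 0 <= odds sg b q.
Proof. by rewrite /odds; case: ifP => // _; case: ifP => _; exact: sqrtr_ge0. Qed.

(** The common value is what makes the increment centred. With division by 0 equal to 0, it also
    holds at [q = 0] and [q = 1]. *)
Lemma mul_odds (q : R) : 0 <= q <= 1 ->
  q * odds false true q = Num.sqrt (q * (1 - q)) /\
  (1 - q) * odds true false q = Num.sqrt (q * (1 - q)).
Proof.
have half (x y : R) : 0 <= x -> 0 <= y -> x * Num.sqrt (y / x) = Num.sqrt (x * y).
  move=> x0 y0; have [->|xn0] := eqVneq x 0; first by rewrite !mul0r sqrtr0.
  have -> : x * y = x ^+ 2 * (y / x) by field.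
  by rewrite [RHS]sqrtrM ?sqr_ge0// sqrtr_sqr ger0_norm.
move=> /andP[q0 q1]; rewrite /odds /= !half ?subr_ge0//; split=> //.
by rewrite mulrC.
Qed.

Lemma mul_odds_sqr_le (q : R) : 0 <= q <= 1 ->
  q * odds false true q ^+ 2 <= 1 - q /\ (1 - q) * odds true false q ^+ 2 <= q.
Proof.
have half (x y : R) : 0 <= x -> 0 <= y -> x * Num.sqrt (y / x) ^+ 2 <= y.
  move=> x0 y0; rewrite sqr_sqrtr ?divr_ge0//.
  have [->|xn0] := eqVneq x 0; first by rewrite mul0r.
  by rewrite mulrCA divff ?mulr1.
by move=> /andP[q0 q1]; rewrite /odds /= !half ?subr_ge0//.
Qed.

End Odds.

(** * Clusters *)

Section Clusters.
Variables (R : realType) (G : weighted_graph R).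
Implicit Types (S : set (edge G)) (u v : vertex G) (K : set (vertex G)).

Definition touches K (e : edge G) : Prop := K (ends e).1 \/ K (ends e).2.

(* [csize K] is [0] when [K] is infinite. *)
Definition csize K : nat := #|` fset_set K|%fset.

(** The number of orientations of [e] that start at [v]; a loop counts twice. *)
Definition incidence (e : edge G) v : nat :=
  (((ends e).1 == v) + ((ends e).2 == v))%N.

Lemma cluster_refl S v : cluster S v v.
Proof. exact: rt_refl. Qed.

Lemma joinsC (e : edge G) u v : joins e u v -> joins e v u.
Proof. by case; [right|left]. Qed.

Lemma cluster_sym S u v : cluster S u v -> cluster S v u.
Proof.
rewrite /cluster /=; elim=> [x y [e Se exy]|x|x y z _ yx _ zy].
- by apply: rt_step; exists e => //; exact: joinsC.
- exact: rt_refl.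
- exact: rt_trans zy yx.
Qed.

Lemma cluster_trans S u v w : cluster S u v -> cluster S v w -> cluster S u w.
Proof. exact: rt_trans. Qed.

Lemma cluster_eq S u v : cluster S u v -> cluster S u = cluster S v.
Proof.
move=> uv; apply/seteqP; split=> w.
  exact: cluster_trans (cluster_sym uv).
exact: cluster_trans.
Qed.

Lemma cluster_neq S u v : cluster S u <> cluster S v <-> ~ cluster S u v.
Proof.
split=> [uv /cluster_eq//|uv E]; apply: uv; rewrite E; exact: cluster_refl.
Qed.

Lemma cluster_mono S S' v : S `<=` S' -> cluster S v `<=` cluster S' v.
Proof.
move=> SS' u; rewrite /cluster /=; elim=> [x y [e Se exy]|x|x y z _ yx _ zy].
- by apply: rt_step; exists e => //; exact: SS'.
- exact: rt_refl.
- exact: rt_trans yx zy.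
Qed.

Lemma cluster_edge S (e : edge G) : S e -> cluster S (ends e).1 (ends e).2.
Proof. by move=> Se; apply: rt_step; exists e => //; left; case: (ends e). Qed.

Lemma cluster_ind S v K : K v ->
  (forall e, S e -> touches K e -> K (ends e).1 /\ K (ends e).2) ->
  cluster S v `<=` K.
Proof.
move=> Kv Kcl u; rewrite /cluster /= => vu; elim: vu Kv => //.
- move=> x y [e Se [exy|exy]] Kx.
    by have [|_] := Kcl e Se; rewrite /touches exy /=; [left|].
  by have [|] := Kcl e Se; rewrite /touches exy /=; [right|].
- by move=> x y z _ xy _ yz /xy.
Qed.

Definition reach S K : set (vertex G) := [set u | exists2 v, K v & cluster S v u].

Lemma reach1 S v : reach S [set v] = cluster S v.
Proof.
by apply/seteqP; split=> [u [_ -> //]|u vu]; exists v.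
Qed.

Lemma sub_reach S K : K `<=` reach S K.
Proof. by move=> v Kv; exists v => //; exact: cluster_refl. Qed.

Lemma reach_closed S K (e : edge G) : S e -> touches (reach S K) e ->
  reach S K (ends e).1 /\ reach S K (ends e).2.
Proof.
move=> Se [] [v Kv] vx; split; exists v => //; apply: cluster_trans vx _.
- exact: cluster_edge.
- exact: cluster_sym (cluster_edge Se).
Qed.

Lemma reach_min S K K' : K `<=` K' ->
  (forall e, S e -> touches K' e -> K' (ends e).1 /\ K' (ends e).2) ->
  reach S K `<=` K'.
Proof. by move=> KK' K'cl u [v /KK' K'v]; exact: cluster_ind. Qed.

Lemma reach_id S K : (forall e, S e -> ~ touches K e) -> reach S K = K.
Proof.
move=> SK; apply/seteqP; split; last exact: sub_reach.
by apply: reach_min => // e /SK.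
Qed.

(** Finding [e] open is the same as enlarging the explored set by its endpoints and forgetting [e],
    so the exploration can continue with one edge fewer. *)
Lemma reachU1 S K (e : edge G) : touches K e ->
  reach (e |` S) K = reach S (K `|` [set (ends e).1; (ends e).2]).
Proof.
move=> Ke; apply/seteqP; split.
  apply: reach_min => [v Kv|f]; first by apply: sub_reach; left.
  move=> [->|Sf fr]; last exact: reach_closed.
  by split; apply: sub_reach; right; [left|right].
have eR : reach (e |` S) K (ends e).1 /\ reach (e |` S) K (ends e).2.
  apply: reach_closed; first by left.
  by case: Ke => ?; [left|right]; exact: sub_reach.
apply: reach_min => [v [/sub_reach//|[->|->]]|f Sf fr]; [by case: eR|by case: eR|].
by apply: reach_closed => //; right.
Qed.

Lemma finite_reach S K (s : seq (edge G)) : S `<=` [set` s] -> finite_set K ->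
  finite_set (reach S K).
Proof.
move=> Ss Kfin.
apply: (@sub_finite_set _ _
  (K `|` [set` [seq (ends e).1 | e <- s] ++ [seq (ends e).2 | e <- s]])).
  apply: reach_min => [v Kv|e /Ss /= es _]; first by left.
  split; right => /=; rewrite mem_cat; apply/orP; [left|right]; exact: map_f.
by rewrite finite_setU; split => //; exact: finite_seq.
Qed.

End Clusters.

(** * Exploration of a cluster *)

Section Exploration.
Variables (R : realType) (G : weighted_graph R) (q : edge G -> R).
Hypothesis q01 : forall e, 0 <= q e <= 1.
Implicit Types (S : set (edge G)) (K : set (vertex G)) (C : {fset vertex G}).

Definition fluct (w : edge G -> R) (s : seq (edge G)) S K : R :=
  \sum_(e <- s) w e * (odds true `[<S e>] (q e) - odds false `[<S e>] (q e)) *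
    `[<touches K e>]%:R.

Definition cumul (g : nat -> R) (k : nat) : R := \sum_(1 <= c < k.+1) g c.

Lemma csize_fset C : csize [set` C] = #|` C|%fset.
Proof. by rewrite /csize set_fsetK. Qed.

Variables (g : nat -> R) (w : edge G -> R) (W2 : R).
Hypothesis g_ge0 : forall k, 0 <= g k.
Hypothesis g_dec : forall k, (0 < k)%N -> g k.+1 <= g k.
Hypothesis W2P : forall v (t : seq (edge G)), uniq t ->
  \sum_(e <- t) (incidence e v)%:R * w e ^+ 2 <= W2.

Lemma touching_weight_le C (D : seq (edge G)) : uniq D ->
  (forall e, e \in D -> touches [set` C] e) ->
  \sum_(e <- D) w e ^+ 2 <= #|` C|%fset%:R * W2.
Proof.
move=> uD DC.
apply: (@le_trans _ _ (\sum_(v <- C) \sum_(e <- D) (incidence e v)%:R * w e ^+ 2)).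
  rewrite exchange_big/= big_seq [leRHS]big_seq; apply: ler_sum => e eD.
  rewrite -mulr_suml -natr_sum ler_peMl ?sqr_ge0// ler1n.
  have [v vC ve] : exists2 v, v \in C & (0 < incidence e v)%N.
    case: (DC e eD) => /= eC.
      by exists (ends e).1 => //; rewrite /incidence eqxx.
    by exists (ends e).2 => //; rewrite /incidence eqxx addn1.
  by rewrite (big_rem v)//= ltn_addr.
apply: (@le_trans _ _ (\sum_(v <- C) W2)).
  by apply: ler_sum => v _; exact: W2P.
by rewrite big_const_seq count_predT iter_addr_0 mulr_natl.
Qed.

(** The potential [g k * (z ^+ 2 + (k%:R * W2 - W)) - W2 * cumul g k] is a supermartingale. The
    centred increment raises the mean of [z ^+ 2] by at most [u ^+ 2], which the growth of [W] pays
    for. A new vertex adds [g k' * W2] to both terms, which cancel; then [g k'] is replaced by the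
    larger [g k], using that the remaining slack is nonnegative. *)
Lemma exploration_step (t z W u : R) (k k' : nat) (e : edge G) :
  t = q e -> (0 < k)%N -> W + u ^+ 2 <= k%:R * W2 -> k' = k \/ k' = k.+1 ->
  t * (g k' * ((z - u * odds false true t) ^+ 2 + (k'%:R * W2 - (W + u ^+ 2))) -
       W2 * cumul g k') +
  (1 - t) * (g k * ((z + u * odds true false t) ^+ 2 + (k%:R * W2 - (W + u ^+ 2))) -
       W2 * cumul g k) <=
  g k * (z ^+ 2 + (k%:R * W2 - W)) - W2 * cumul g k.
Proof.
move=> te k0 WW kk; have t01 : 0 <= t <= 1 by rewrite te.
have [m1 m2] := mul_odds t01; have [v1 v2] := mul_odds_sqr_le t01.
have /andP[t0 t1] := t01.
set a := odds false true t in m1 v1 *; set b := odds true false t in m2 v2 *.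
set X := k%:R * W2 - (W + u ^+ 2); have X0 : 0 <= X by rewrite subr_ge0.
have step : g k' * ((z - u * a) ^+ 2 + (k'%:R * W2 - (W + u ^+ 2))) -
       W2 * cumul g k' <= g k * ((z - u * a) ^+ 2 + X) - W2 * cumul g k.
  case: kk => -> //; rewrite /cumul big_nat_recr//= -/(cumul g k).
  have -> : k.+1%:R * W2 - (W + u ^+ 2) = X + W2 by rewrite /X -natr1; ring.
  have := g_dec k0; rewrite -subr_ge0 => gk.
  have Y0 : 0 <= (z - u * a) ^+ 2 + X by rewrite addr_ge0// sqr_ge0.
  have := mulr_ge0 gk Y0; rewrite -subr_ge0; lra.
have step' := ler_wpM2l t0 step.
apply: (le_trans (lerD step' (lexx _))).
rewrite -subr_ge0.
have -> : g k * (z ^+ 2 + (k%:R * W2 - W)) - W2 * cumul g k -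
  (t * (g k * ((z - u * a) ^+ 2 + X) - W2 * cumul g k) +
   (1 - t) * (g k * ((z + u * b) ^+ 2 + X) - W2 * cumul g k)) =
  g k * (u ^+ 2 * (1 - (t * a ^+ 2 + (1 - t) * b ^+ 2)) +
    2 * z * u * (t * a - (1 - t) * b)) by rewrite /X; ring.
rewrite m1 m2 subrr mulr0 addr0; apply: mulr_ge0 => //; apply: mulr_ge0.
  exact: sqr_ge0.
by rewrite subr_ge0; apply: (le_trans (lerD v1 v2)); rewrite subrK.
Qed.

(* Edges of [s] are revealed one at a time, each chosen to touch the part [C]
   of the cluster found so far; [D] lists those already revealed and [z] is the
   current value of the martingale.  Each revealed edge [e] adds at most
   [w e ^+ 2] to the second moment, and is charged to the budget [W2] of a
   vertex of [C]; as [g] is nonincreasing, the budget of the [c]-th vertex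
   counts at most [g c * W2]. *)
Lemma exploration_bound (s D : seq (edge G)) C z : uniq (D ++ s) ->
  (0 < #|` C|%fset)%N -> (forall e, e \in D -> touches [set` C] e) ->
  bexp q s (fun S => g (csize (reach S [set` C])) *
      (z + fluct w s S (reach S [set` C])) ^+ 2 -
      W2 * cumul g (csize (reach S [set` C]))) <=
  g #|` C|%fset * (z ^+ 2 + (#|` C|%fset%:R * W2 - \sum_(e <- D) w e ^+ 2)) -
    W2 * cumul g #|` C|%fset.
Proof.
have [m sm] := ubnP (size s).
elim: m s D C z sm => [//|m IH] s D C z; rewrite ltnS => sm uDs C0 DC.
have [uD [Ds us]] : uniq D /\ {in D, forall e, e \notin s} /\ uniq s.
  move: uDs; rewrite cat_uniq => /and3P[-> /hasPn ns ->]; split=> //; split=> //.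
  by move=> e eD; apply/negP => /ns; rewrite /= eD.
have [/hasP[e es /asboolP eC]|/hasPn nC] :=
  boolP (has (fun e => `[<touches [set` C] e>]) s); last first.
  (* No unrevealed edge touches [C], so the cluster is exactly [C] and [z] is final; the leftover
     slack is nonnegative. *)
  rewrite (@eq_bexp _ _ _ _ _
    (fun=> g #|` C|%fset * z ^+ 2 - W2 * cumul g #|` C|%fset)); last first.
    move=> S Ss; have rC : reach S [set` C] = [set` C].
      by apply: reach_id => e /Ss /= /nC /asboolPn.
    rewrite rC csize_fset /fluct big1_seq ?addr0// => e /andP[_ /nC nt].
    by rewrite (negbTE nt) mulr0.
  rewrite bexp_cst lerD2r// ler_wpM2l// lerDl subr_ge0.
  exact: touching_weight_le.
set C' := ((ends e).1 |` ((ends e).2 |` C))%fset.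
have C'E : [set` C'] = [set` C] `|` [set (ends e).1; (ends e).2].
  apply/seteqP; split=> v /=; rewrite !inE.
    by move=> /or3P[/eqP ->|/eqP ->|vC]; [right; left|right; right|left].
  by move=> [->|[->|->]]; rewrite ?eqxx ?orbT.
have uDs' : uniq ((e :: D) ++ rem e s).
  have pe : perm_eq ((e :: D) ++ rem e s) (D ++ s).
    by rewrite cat_cons -cat1s perm_catCA perm_cat2l cat1s perm_sym perm_to_rem.
  by rewrite (perm_uniq pe).
have srem : (size (rem e s) < m)%N.
  by rewrite size_rem//; case: (s) es sm => [//|? ? _ /=].
have k' : #|` C'|%fset = #|` C|%fset \/ #|` C'|%fset = #|` C|%fset.+1.
  rewrite !cardfsU1 !inE; case: eC => /= ->; rewrite ?orbT /= ?add0n.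
    by case: ((ends e).2 \notin C); [right|left].
  by case: (_ || _); [left|right].
have k'0 : (0 < #|` C'|%fset)%N by case: k' => ->.
have De : forall f, f \in e :: D -> touches [set` C] f.
  by move=> f; rewrite inE => /predU1P[-> //|/DC].
have eDn : e \notin D by apply/negP => /Ds; rewrite es.
have eremn S : S `<=` [set` rem e s] -> ~ S e.
  by move=> Ss /Ss /=; rewrite mem_rem_uniq// inE eqxx.
have split_fluct S K : touches K e -> S `<=` [set` rem e s] ->
    (fluct w s (e |` S) K =
       - (w e * odds false true (q e)) + fluct w (rem e s) S K) *
    (fluct w s S K = w e * odds true false (q e) + fluct w (rem e s) S K).
  move=> Ke Ss.
  rewrite /fluct !(big_rem e es)/= (asboolT Ke) mulr1 asboolT; last by left.
  rewrite (asboolF (eremn _ Ss)) /odds /= sub0r subr0 mulr1 mulrN; split=> //.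
  congr (_ + _); apply: eq_big_seq => f fs.
  have -> // : `[<(e |` S) f>] = `[<S f>].
  apply/asbool_equiv_eq; split=> [[fe|//]|]; last by right.
  by move: fs; rewrite mem_rem_uniq// inE fe eqxx.
have := @exploration_step (q e) z (\sum_(e <- D) w e ^+ 2) (w e)
  #|` C|%fset #|` C'|%fset e erefl C0 _ k'.
rewrite addrC -[_ + \sum_(_ <- _) _](big_cons _ _ e D xpredT (fun e => w e ^+ 2)).
move=> /(_ _) step; apply: le_trans (step _); last first.
  by apply: touching_weight_le => //=; rewrite eDn.
rewrite (bexp_rem _ _ es).
have /andP[q0 q1] := q01 e.
apply: lerD; apply: ler_wpM2l; rewrite ?subr_ge0//.
  apply: le_trans (IH (rem e s) (e :: D) C' (z - w e * odds false true (q e)) srem uDs' k'0 _).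
    apply: bexp_le => // S Ss /=; rewrite reachU1// -C'E.
    have tC : touches (reach S [set` C']) e.
      by case: eC => eC; [left|right]; apply: sub_reach; rewrite C'E; left.
    by rewrite (split_fluct _ _ tC Ss).1 addrA.
  move=> f /De [] fC; [left|right]; rewrite C'E; by left.
apply: le_trans (IH (rem e s) (e :: D) C (z + w e * odds true false (q e)) srem uDs' C0 De).
apply: bexp_le => // S Ss.
have tC : touches (reach S [set` C]) e.
  by case: eC => eC; [left|right]; apply: sub_reach.
by rewrite (split_fluct _ _ tC Ss).2 addrA.
Qed.

Lemma cluster_fluct_bound (s : seq (edge G)) v : uniq s ->
  bexp q s (fun S => g (csize (cluster S v)) * fluct w s S (cluster S v) ^+ 2) <=
  W2 * bexp q s (fun S => cumul g (csize (cluster S v))).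
Proof.
move=> us.
have := @exploration_bound s [::] [fset v]%fset 0 us.
rewrite cardfs1 big_nil => /(_ isT) bound.
have {bound} := bound (fun _ h => ltac:(by [])).
(* At a single vertex with [z = 0] the potential is [g 1 * W2 - W2 * g 1 = 0]. *)
rewrite expr0n /= add0r subr0 mul1r {2}/cumul big_nat1 mulrC subrr => bound.
rewrite -subr_le0 -bexpZ -mulN1r -bexpZ -bexpD; apply: le_trans bound.
apply: bexp_le => // S _.
have -> : [set` [fset v]%fset] = [set v] by apply/seteqP; split=> u /=; rewrite !inE => /eqP.
by rewrite reach1 add0r mulN1r.
Qed.

End Exploration.

(** * Cluster weights and opening an edge *)

Section ClusterSize.
Variables (R : realType) (G : weighted_graph R).
Implicit Types (S : set (edge G)) (u v : vertex G) (K : set (vertex G)).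

Lemma csize_infinite K : infinite_set K -> csize K = 0%N.
Proof. by rewrite /csize /fset_set; case: pselect. Qed.

Lemma csize_gt0 K v : finite_set K -> K v -> (0 < csize K)%N.
Proof.
move=> Kfin Kv; rewrite /csize cardfs_gt0; apply/negP => /eqP /fset_set_set0 K0.
by move: Kv; rewrite K0.
Qed.

Lemma csize_finite K : (0 < csize K)%N -> finite_set K.
Proof. by move=> K0; apply: contrapT => /csize_infinite E; rewrite E in K0. Qed.

Lemma card_geP n K : (`I_n #<= K)%card <->
  exists2 B : {fset vertex G}, [set` B] `<=` K & (n <= #|` B|%fset)%N.
Proof.
split=> [nK|[B BK nB]].
  have [Kfin|/(@infinite_set_fset _ _ n)//] := pselect (finite_set K).
  by exists (fset_set K); [rewrite fset_setK|exact: leq_card_fset_set].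
apply: card_le_trans (subset_card_le BK).
have [m Bm] := (finite_setP _).1 (finite_fset B).
by rewrite (card_le_eqr Bm) card_le_II -(card_fset_set Bm) set_fsetK.
Qed.

Lemma card_ge_csize n K : finite_set K -> (`I_n #<= K)%card <-> (n <= csize K)%N.
Proof.
move=> Kfin; split=> [|nK]; first exact: leq_card_fset_set.
by apply/card_geP; exists (fset_set K) => //; rewrite fset_setK.
Qed.

Lemma csize_le K K' : finite_set K' -> K `<=` K' -> (csize K <= csize K')%N.
Proof.
move=> K'fin KK'; have Kfin := sub_finite_set KK' K'fin.
by apply: fsubset_leq_card; rewrite -fset_set_sub.
Qed.

Lemma csizeU K K' : finite_set K -> finite_set K' -> K `&` K' = set0 ->
  csize (K `|` K') = (csize K + csize K')%N.
Proof.
move=> Kfin K'fin KK'.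
by rewrite /csize fset_setU// -cardfsUI -fset_setI// KK' fset_set0 cardfs0 addn0.
Qed.

(* The weight [min (k / n) 1] of a cluster of size [k], cut off above [L]; as
   [csize] is [0] on infinite clusters, these get weight [0] as well. *)
Definition capped (n L k : nat) : R :=
  if (0 < k <= L)%N then (minn k n)%:R / n%:R else 0.

Lemma capped_ge0 n L k : 0 <= capped n L k.
Proof. by rewrite /capped; case: ifP => // _; rewrite divr_ge0. Qed.

Lemma capped_le1 n L k : (0 < n)%N -> capped n L k <= 1.
Proof.
move=> n0; rewrite /capped; case: ifP => // _.
by rewrite ler_pdivrMr ?ltr0n// mul1r ler_nat geq_minr.
Qed.

(** The cut-off preserves subadditivity: it can only annihilate the left side first, since
    [a + b <= L] forces [a <= L] and [b <= L]. *)
Lemma cappedD n L a b : capped n L (a + b) <= capped n L a + capped n L b.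
Proof.
have [->|a0] := posnP a; first by rewrite add0n lerDr capped_ge0.
have [->|b0] := posnP b; first by rewrite addn0 lerDl capped_ge0.
rewrite {1}/capped; case: ifP => [/andP[_ abL]|_]; last first.
  by rewrite addr_ge0 ?capped_ge0.
rewrite /capped a0 b0 (leq_trans _ abL) ?leq_addr//= (leq_trans _ abL) ?leq_addl//=.
by rewrite -mulrDl ler_wpM2r ?invr_ge0// -natrD ler_nat; lia.
Qed.

(** If [a + b <= L], all three weights are 1. Otherwise the merged cluster has weight 0, and one of
    the two parts still has weight 1. *)
Lemma cappedD_ge n L a b : (0 < n <= a)%N -> (n <= b)%N ->
  (a <= L)%N || (b <= L)%N ->
  1 + capped n L (a + b) <= capped n L a + capped n L b.
Proof.
move=> /andP[n0 na] nb abL; have a0 := leq_trans n0 na; have b0 := leq_trans n0 nb.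
have one k : (n <= k)%N -> (k <= L)%N -> capped n L k = 1.
  move=> nk kL; rewrite /capped (leq_trans n0 nk) kL /= (minn_idPr nk).
  by rewrite divff// pnatr_eq0 -lt0n.
have [abL'|abL'] := leqP (a + b) L.
  by rewrite (one (a + b)%N) ?(one a) ?(one b)//; lia.
have -> : capped n L (a + b) = 0 by rewrite /capped [X in _ && X]leqNgt abL' andbF.
rewrite addr0; case/orP: abL => [/one ->//|/one ->//].
  by rewrite lerDl capped_ge0.
by rewrite lerDr capped_ge0.
Qed.

End ClusterSize.

Section Insertion.
Variables (R : realType) (G : weighted_graph R) (q : edge G -> R).
Hypothesis q01 : forall e, 0 <= q e <= 1.
Implicit Types (S : set (edge G)) (e : edge G).
Variables (n L : nat).
Hypothesis n0 : (0 < n)%N.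

(** The lower bound [0 < csize] excludes infinite clusters, whose [csize] is 0. *)
Definition two_clusters_le e S : Prop :=
  two_clusters e n S /\
  ((0 < csize (cluster S (ends e).1) <= L)%N \/
   (0 < csize (cluster S (ends e).2) <= L)%N).

Definition cluster_weight e S : R :=
  capped R n L (csize (cluster S (ends e).1)) +
  `[<~ cluster S (ends e).1 (ends e).2>]%:R *
    capped R n L (csize (cluster S (ends e).2)).

Lemma cluster_weight_ge0 e S : 0 <= cluster_weight e S.
Proof. by rewrite addr_ge0 ?mulr_ge0 ?capped_ge0. Qed.

Lemma cluster_weight_le2 e S : cluster_weight e S <= 2.
Proof.
apply: (@le_trans _ _ (1 + 1)); last by rewrite -natr1.
rewrite lerD ?capped_le1//; case: asboolP => _; rewrite ?mul1r ?mul0r ?capped_le1//.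
Qed.

Lemma clusterU1 S e : cluster (e |` S) (ends e).1 =
  cluster S (ends e).1 `|` cluster S (ends e).2.
Proof.
rewrite -reach1 reachU1; last by left.
apply/seteqP; split=> u; last first.
  by move=> [] uc; [exists (ends e).1|exists (ends e).2] => //; right; [left|right].
by move=> [v [->|[->|->]]] vu; [left|left|right].
Qed.

(* Opening [e] merges its two clusters, and [capped] is subadditive. *)
Lemma cluster_weight_drop S e : finite_set (cluster S (ends e).1) ->
  finite_set (cluster S (ends e).2) ->
  `[<two_clusters_le e S>]%:R + cluster_weight e (e |` S) <= cluster_weight e S.
Proof.
move=> f1 f2; have eS : (e |` S) e by left.
rewrite /cluster_weight (@asboolF (~ cluster (e |` S) _ _)); last first.
  by move=> nc; apply: nc; exact: cluster_edge.
rewrite mul0r addr0 clusterU1.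
have [c12|nc12] := pselect (cluster S (ends e).1 (ends e).2).
  rewrite (cluster_eq c12) setUid (@asboolF (two_clusters_le _ _)); last first.
    by move=> [[/= K12 _ _ _] _]; apply: K12; exact: cluster_eq.
  rewrite add0r (@asboolF (~ _)) ?mul0r ?addr0//; move=> nc; apply: nc.
  exact: cluster_refl.
rewrite (@asboolT (~ cluster S _ _))// mul1r csizeU//; last first.
  rewrite -subset0 => u [u1 u2]; apply: nc12.
  exact: cluster_trans u1 (cluster_sym u2).
case: asboolP => [[[_ K1 K2 _] KL]|_]; last by rewrite add0r cappedD.
rewrite cappedD_ge ?n0//=.
- exact/card_ge_csize.
- exact/card_ge_csize.
- by case: KL => /andP[_ ->]; rewrite ?orbT.
Qed.

(** With the other edges fixed, the closed state of [e] in the positive part and the open state in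
    the negative part carry the same total mass [sqrt (q (1 - q))], so the pointwise drop of the
    cluster weight can be integrated. *)
Lemma insertion_bound (s : seq (edge G)) e : uniq s -> e \in s ->
  bexp q s (fun S => odds true `[<S e>] (q e) * `[<two_clusters_le e S>]%:R) +
  bexp q s (fun S => odds false `[<S e>] (q e) * cluster_weight e S) <=
  bexp q s (fun S => odds true `[<S e>] (q e) * cluster_weight e S).
Proof.
move=> us es; rewrite -bexpD !(bexp_rem _ _ es).
have [m1 m2] := mul_odds (q01 e); set t := Num.sqrt _ in m1 m2.
have t0 : 0 <= t by exact: sqrtr_ge0.
rewrite -!bexpZ -!bexpD; apply: bexp_le => // S Ss.
have nSe : ~ S e by move=> /Ss /=; rewrite mem_rem_uniq// inE eqxx.
rewrite asboolT; last by left.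
rewrite (asboolF nSe) {1 3 4 6}/odds /= !mul0r !addr0 add0r mulr0 add0r.
rewrite !mulrA m1 m2 addrC -mulrDr ler_wpM2l//; apply: cluster_weight_drop.
- rewrite -reach1; apply: finite_reach (@finite_set1 _ _) => x /Ss; exact: mem_rem.
- rewrite -reach1; apply: finite_reach (@finite_set1 _ _) => x /Ss; exact: mem_rem.
Qed.

End Insertion.

(** * Finite truncations *)

Section Truncation.
Variables (R : realType) (G : weighted_graph R).
Implicit Types (S : set (edge G)) (e : edge G) (u v : vertex G).

Definition edges_below (N : nat) : seq (edge G) :=
  pmap (@pickle_inv (edge G)) (iota 0 N).

Lemma edges_below_uniq N : uniq (edges_below N).
Proof. exact: pmap_uniq (@pickle_invK _) _ (iota_uniq _ _). Qed.

Lemma mem_edges_below N e : (e \in edges_below N) = (choice.pickle e < N)%N.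
Proof.
rewrite mem_pmap; apply/mapP/idP => [[k]|eN].
  rewrite mem_iota add0n => /andP[_ kN] ek.
  by have := @pickle_invK (edge G) k; rewrite -ek /= => ->.
by exists (choice.pickle e); rewrite ?mem_iota// pickleK_inv.
Qed.

Definition keep_below S N : set (edge G) := S `&` [set` edges_below N].

Lemma near_edges_below e : \forall N \near \oo, e \in edges_below N.
Proof.
near=> N; rewrite mem_edges_below; near: N; exact: nbhs_infty_gt.
Unshelve. all: by end_near. Qed.

Lemma near_sub_edges_below (s : seq (edge G)) :
  \forall N \near \oo, {subset s <= edges_below N}.
Proof.
elim: s => [|e s IH]; first by near=> N.
near=> N => f; rewrite inE => /predU1P[->|].
  by near: N; exact: near_edges_below.
by move: f; near: N.
Unshelve. all: by end_near. Qed.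

Lemma keep_below_sub S N : keep_below S N `<=` S.
Proof. exact: subIsetl. Qed.

Lemma finite_cluster_below S N v : finite_set (cluster (keep_below S N) v).
Proof.
rewrite -reach1; apply: (@finite_reach _ _ _ _ (edges_below N)) (finite_set1 _).
exact: subIsetr.
Qed.

Lemma near_cluster_below S u v : cluster S u v ->
  \forall N \near \oo, cluster (keep_below S N) u v.
Proof.
elim=> [x y [e Se exy]|x|x y z _ IH1 _ IH2].
- near=> N; apply: rt_step; exists e => //; split => //=.
  by near: N; exact: near_edges_below.
- by near=> N; exact: cluster_refl.
- near=> N; apply: (@cluster_trans _ _ _ _ y); by near: N.
Unshelve. all: by end_near. Qed.

Lemma near_sub_cluster_below S v (B : {fset vertex G}) :
  [set` B] `<=` cluster S v ->
  \forall N \near \oo, [set` B] `<=` cluster (keep_below S N) v.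
Proof.
move=> BK.
have nearB : \oo (\bigcap_(u in [set` B]) [set N | cluster (keep_below S N) v u]).
  by apply: filter_bigI => u uB; apply: near_cluster_below; exact: BK.
by apply: filterS nearB => N cB u /cB.
Qed.

Lemma near_cluster_below_eq S v : finite_set (cluster S v) ->
  \forall N \near \oo, cluster (keep_below S N) v = cluster S v.
Proof.
move=> Kfin; have := @near_sub_cluster_below S v (fset_set (cluster S v)).
rewrite fset_setK// => /(_ (@subset_refl _ _)); apply: filterS => N sub.
by apply/seteqP; split => //; exact: cluster_mono (@keep_below_sub _ _).
Qed.

(** Eventual equality needs no topology on [T] and passes through products and boolean combinations.
    It yields both measurability and dominated convergence. *)
Definition stable (T : Type) (f : set (edge G) -> T) :=
  forall S, \forall N \near \oo, f (keep_below S N) = f S.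

Lemma stable_cluster u v : stable (fun S => `[<cluster S u v>]).
Proof.
move=> S; have [uv|nuv] := pselect (cluster S u v); near=> N.
  rewrite !asboolT//; near: N; exact: near_cluster_below.
by rewrite !asboolF// => /(cluster_mono (@keep_below_sub _ _)).
Unshelve. all: by end_near. Qed.

Lemma stable_card_ge n v : stable (fun S => `[<(`I_n #<= cluster S v)%card>]).
Proof.
move=> S; have [/card_geP[B BK nB]|nK] := pselect (`I_n #<= cluster S v)%card.
  near=> N; rewrite !asboolT//; apply/card_geP; exists B => //.
  by near: N; exact: near_sub_cluster_below.
near=> N; rewrite !asboolF//; apply: contra_not nK => /card_le_trans; apply.
by apply: subset_card_le; apply: cluster_mono; exact: keep_below_sub.
Unshelve. all: by end_near. Qed.

Lemma near_cluster_below_large S v L : infinite_set (cluster S v) ->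
  \forall N \near \oo, (L < csize (cluster (keep_below S N) v))%N.
Proof.
move=> /(@infinite_set_fset _ _ L.+1)[B BK LB]; near=> N.
apply: (leq_trans LB); rewrite -csize_fset; apply: csize_le.
  exact: finite_cluster_below.
by near: N; exact: near_sub_cluster_below.
Unshelve. all: by end_near. Qed.

Lemma stable_size_le L v :
  stable (fun S => (0 < csize (cluster S v) <= L)%N).
Proof.
move=> S; have [Kfin|Kinf] := pselect (finite_set (cluster S v)); near=> N.
  suff -> : cluster (keep_below S N) v = cluster S v by [].
  by near: N; exact: near_cluster_below_eq.
rewrite (csize_infinite Kinf) ltnn /= [X in _ && X]leqNgt.
suff -> : (L < csize (cluster (keep_below S N) v))%N by rewrite andbF.
by near: N; exact: near_cluster_below_large.
Unshelve. all: by end_near. Qed.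

Lemma stable_capped n L v : stable (fun S => capped R n L (csize (cluster S v))).
Proof.
move=> S; have [Kfin|Kinf] := pselect (finite_set (cluster S v)); near=> N.
  suff -> : cluster (keep_below S N) v = cluster S v by [].
  by near: N; exact: near_cluster_below_eq.
rewrite /capped; have -> : (0 < csize (cluster (keep_below S N) v) <= L)%N =
    (0 < csize (cluster S v) <= L)%N by near: N; exact: stable_size_le.
by rewrite (csize_infinite Kinf).
Unshelve. all: by end_near. Qed.

Lemma stable_cluster_weight n L e : stable (cluster_weight n L e).
Proof.
move=> S; near=> N; rewrite /cluster_weight; congr (_ + (nat_of_bool _)%:R * _).
- by near: N; exact: stable_capped.
- by rewrite !asbool_neg; congr negb; near: N; exact: stable_cluster.
- by near: N; exact: stable_capped.
Unshelve. all: by end_near. Qed.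

Lemma stable_two_clusters_le n L e : stable (fun S => `[<two_clusters_le n L e S>]).
Proof.
have E S : `[<two_clusters_le n L e S>] =
  [&& ~~ `[<cluster S (ends e).1 (ends e).2>],
     `[<(`I_n #<= cluster S (ends e).1)%card>],
     `[<(`I_n #<= cluster S (ends e).2)%card>] &
     (0 < csize (cluster S (ends e).1) <= L)%N ||
     (0 < csize (cluster S (ends e).2) <= L)%N].
  apply/asboolP/and4P =>
    [[[/= /cluster_neq nK K1 K2 _] KL]|[/asboolPn nK /asboolP K1 /asboolP K2 KL]].
    by split; [exact/asboolPn|exact/asboolP|exact/asboolP|exact/orP].
  split; last exact/orP; split=> //=; first exact/cluster_neq.
  by case/orP: KL => /andP[/csize_finite ? _]; [left|right].
move=> S; near=> N; rewrite !E; congr [&& ~~ _, _, _ & _ || _]; near: N.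
- exact: stable_cluster.
- exact: stable_card_ge.
- exact: stable_card_ge.
- exact: stable_size_le.
- exact: stable_size_le.
Unshelve. all: by end_near. Qed.

(* [cluster_weight n L e S], split evenly over the vertices of the clusters
   touched by [e] (see [esum_share]), so that it can be transported. *)
Definition share n L e v S : R :=
  capped R n L (csize (cluster S v)) / (csize (cluster S v))%:R *
  `[<touches (cluster S v) e>]%:R.

Lemma share_ge0 n L e v S : 0 <= share n L e v S.
Proof. by rewrite !mulr_ge0 ?capped_ge0 ?invr_ge0. Qed.

Lemma share_le1 n L e v S : (0 < n)%N -> share n L e v S <= 1.
Proof.
move=> n0; apply: (@le_trans _ _ (1 * 1)); last by rewrite mulr1.
apply: ler_pM; rewrite ?divr_ge0 ?capped_ge0//; last by case: asboolP.
have [->|k0] := posnP (csize (cluster S v)).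
  by rewrite invr0 mulr0.
rewrite ler_pdivrMr ?ltr0n// mul1r (le_trans (capped_le1 _ _ _ n0))//.
by rewrite ler1n.
Qed.

Lemma stable_share n L e v : stable (share n L e v).
Proof.
move=> S; have [Kfin|Kinf] := pselect (finite_set (cluster S v)); near=> N.
  rewrite /share; suff -> : cluster (keep_below S N) v = cluster S v by [].
  by near: N; exact: near_cluster_below_eq.
have Ec : capped R n L (csize (cluster (keep_below S N) v)) =
    capped R n L (csize (cluster S v)) by near: N; exact: stable_capped.
by rewrite /share Ec (csize_infinite Kinf) /capped /= !mul0r.
Unshelve. all: by end_near. Qed.

End Truncation.

(** * Equivariance under automorphisms *)

Section Relabelling.
Variables (R : realType) (G : weighted_graph R) (gam : graph_map G).
Hypothesis gam_aut : Aut gam.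
Implicit Types (S : set (edge G)) (e : edge G) (u v : vertex G).

Local Notation gv := (on_vertex gam).
Local Notation ge := (on_edge gam).

Lemma on_vertex_inj : injective gv.
Proof. by case: gam_aut => /bij_inj. Qed.

Lemma on_edge_inj : injective ge.
Proof. by case: gam_aut => _ /bij_inj. Qed.

Lemma ends_on_edge e :
  ends (ge e) = (gv (ends e).1, gv (ends e).2) \/
  ends (ge e) = (gv (ends e).2, gv (ends e).1).
Proof.
by case: gam_aut => _ _ + _ => /(_ e (ends e).1 (ends e).2); apply; left; case: (ends e).
Qed.

Lemma incidence_on e v : incidence (ge e) (gv v) = incidence e v.
Proof.
rewrite /incidence; case: (ends_on_edge e) => -> /=; rewrite !(inj_eq on_vertex_inj)//.
by rewrite addnC.
Qed.

Lemma touches_on (K : set (vertex G)) e : touches (gv @` K) (ge e) <-> touches K e.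
Proof.
have im u : (gv @` K) (gv u) <-> K u.
  by split=> [[w Kw /on_vertex_inj <-]|Ku] //; exists u.
rewrite /touches -(im (ends e).1) -(im (ends e).2).
by case: (ends_on_edge e) => ->; split=> -[]; by [left|right].
Qed.

Lemma cluster_on S v : cluster S (gv v) = gv @` cluster (ge @^-1` S) v.
Proof.
apply/seteqP; split.
  apply: cluster_ind; first by exists v => //; exact: cluster_refl.
  have [ge' geK geK'] : bijective ge by case: gam_aut.
  move=> f; rewrite -(geK' f); set e := ge' f => Se /touches_on te.
  have [k1 k2] : cluster (ge @^-1` S) v (ends e).1 /\ cluster (ge @^-1` S) v (ends e).2.
    rewrite -(reach1 _ v); apply: reach_closed => //; by rewrite reach1.
  by case: (ends_on_edge e) => -> /=; split; [exists (ends e).1|exists (ends e).2|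
    exists (ends e).2|exists (ends e).1].
move=> _ [u vu <-]; elim: vu => [x y [e Se exy]|x|x y z _ xy _ yz].
- apply: rt_step; exists (ge e) => //.
  by case: gam_aut => _ _ + _; apply.
- exact: cluster_refl.
- exact: cluster_trans xy yz.
Qed.

Lemma csize_image (K : set (vertex G)) : csize (gv @` K) = csize K.
Proof.
have [Kfin|Kinf] := pselect (finite_set K).
  rewrite /csize fset_set_image// card_imfset//; exact: on_vertex_inj.
rewrite !csize_infinite// => fin; apply: Kinf.
apply: (@sub_finite_set _ _ (gv @^-1` (gv @` K))) => [u Ku|]; first by exists u.
by apply: finite_preimage fin => u w _ _ /on_vertex_inj.
Qed.

Lemma share_on n L e v S :
  share n L (ge e) (gv v) S = share n L e v (ge @^-1` S).
Proof.
rewrite /share cluster_on csize_image; congr (_ * _%:R); congr nat_of_bool.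
by apply/asbool_equiv_eq; exact: touches_on.
Qed.

End Relabelling.

(** * Sampling the configuration given the environment *)

Section IndependentIntegral.
Context d (Om : measurableType d) (R : realType) (P : probability Om R).
Context d1 (T1 : measurableType d1) d2 (T2 : measurableType d2).
Variables (X : {RV P >-> T1}) (Y : {RV P >-> T2}).
Local Open Scope ereal_scope.

(** The joint law agrees with the product of the marginals on rectangles, hence everywhere, and
    Tonelli applies. The inner integral runs over an independent copy of [Om]. *)
Lemma independent_integral (f : T1 * T2 -> \bar R) : independent P X Y ->
  measurable_fun setT f -> (forall z, 0 <= f z) ->
  \int[P]_x f (X x, Y x) = \int[P]_x \int[P]_y f (X x, Y y).
Proof.
move=> XY mf f0.
have mZ : measurable_fun setT (fun x => (X x, Y x)) by exact: measurable_fun_pair.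
pose Z : {mfun Om >-> (T1 * T2)%type} :=
  HB.pack (fun x => (X x, Y x)) (isMeasurableFun.Build _ _ _ _ _ mZ).
have ZE A B : measurable A -> measurable B ->
    distribution P Z (A `*` B) = distribution P X A * distribution P Y B.
  by move=> mA mB; rewrite /= /distribution /pushforward -XY.
rewrite -[LHS](@ge0_integral_distribution _ _ _ _ _ P Z f mf f0).
rewrite (eq_measure_integral (distribution P X \x distribution P Y)); last first.
  by move=> A mA _; apply/esym; exact: (product_measure_unique ZE).
rewrite fubini_tonelli1// /fubini_F ge0_integral_distribution//; last 2 first.
- exact: (measurable_fun_fubini_tonelli_F _ mf f0).
- by move=> y; exact: integral_ge0.
apply: eq_integral => x _ /=; rewrite ge0_integral_distribution//.
exact: measurableT_comp mf (measurable_pair1 _).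
Qed.

End IndependentIntegral.

Section ProductSpaceTheory.
Variables (I : Type) (d : measure_display) (T : measurableType d).

Lemma measurable_coordinate (i : I) :
  measurable_fun setT (fun f : product_space I T => f i).
Proof.
by move=> _ B mB; rewrite setTI; apply: sub_sigma_algebra; exists i, B.
Qed.

Lemma measurable_to_product d' (Om : measurableType d')
    (F : Om -> product_space I T) :
  (forall i, measurable_fun setT (fun x => F x i)) -> measurable_fun setT F.
Proof.
move=> mF; apply: (@measurability _ _ Om (product_space I T) setT F (@cylinders I d T)) => //.
move=> _ [_ [i [B [mB ->]]] <-]; rewrite setTI.
by have := mF i measurableT B mB; rewrite setTI.
Qed.

End ProductSpaceTheory.

Section Environment.
Variables (R : realType) (G : weighted_graph R).
Implicit Types (y : environment G) (e : edge G).

Definition envp y e : R := (y e : {i01 R})%:num.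

Lemma envp01 y e : 0 <= envp y e <= 1.
Proof. by rewrite /envp; apply/andP; split. Qed.

Lemma measurable_envp e : measurable_fun setT (envp^~ e).
Proof.
have mnum : measurable_fun setT (fun x : unit_interval R => (x : {i01 R})%:num : R).
  move=> _ B mB; rewrite setTI; exists B => //; by rewrite setTI.
exact: measurableT_comp mnum (@measurable_coordinate _ _ _ e).
Qed.

End Environment.

Section UniformLabels.
Variable R : realType.

Lemma uniform_prob_le (y : R) (b : bool) : 0 <= y <= 1 ->
  uniform_prob (@ltr01 R) [set r | (r <= y) == b] =
  (if b then y else 1 - y)%:E.
Proof.
move=> /andP[y0 y1].
have le_y : uniform_prob (@ltr01 R) [set r | r <= y] = y%:E.
  rewrite /uniform_prob integral_uniform_pdf.
  have -> : [set r | r <= y] `&` `[0, 1] = `[0, y]%classic :> set R.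
    apply/seteqP; split=> r /=; rewrite !in_itv /=.
      by move=> [ry /andP[-> _]]; rewrite ry.
    by move=> /andP[r0 ry]; rewrite r0 ry (le_trans ry y1).
  rewrite (eq_integral (fun=> 1%E)) => [|r]; last first.
    rewrite inE/= in_itv/= => /andP[r0 ry].
    by rewrite /uniform_pdf r0 (le_trans ry y1) subr0 invr1.
  rewrite integral_cst//= lebesgue_measure_itv/= lte_fin mul1e.
  by case: ltgtP y0 => // [_ _|<- _]; rewrite ?oppr0 ?adde0// EFinN oppe0 adde0.
have mle : measurable [set r : R | r <= y].
  by have := @measurable_itv R `]-oo, y]; rewrite set_itvE.
case: b.
  by rewrite (_ : [set _ | _] = [set r | r <= y])//; apply/seteqP; split=> r /= /eqP.
rewrite (_ : [set _ | _] = ~` [set r | r <= y]); last first.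
  by apply/seteqP; split=> r /=; [move=> /eqP/negP|move=> /negP/negbTE ->].
by rewrite EFinB -le_y; exact: probability_setC.
Qed.

End UniformLabels.

Lemma measurable_eqb d (T : measurableType d) (R : realType) (b : T -> bool) c :
  measurable_fun setT b -> measurable_fun setT (fun x => (b x == c)%:R : R).
Proof.
move=> mb; rewrite (_ : (fun x => _) =
    (fun x => if b x then (true == c)%:R else (false == c)%:R)); last first.
  by apply/funext => x; case: (b x).
exact: measurable_fun_ifT.
Qed.

Section Sampling.
Variables (R : realType) (G : weighted_graph R).
Variables (mu : probability (environment G) R).
Context d (Om : measurableType d) (P : probability Om R).
Variables (p : {RV P >-> environment G}) (U : edge G -> {RV P >-> R}).
Hypothesis perc : percolation_in_environment p U mu.
Implicit Types (e : edge G) (s t : seq (edge G)) (x : Om).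

Local Notation opn := (open_edges p U).

Definition label_open e x : bool := U e x <= envp (p x) e.

Lemma open_edgesE e x : `[<opn x e>] = label_open e x.
Proof. exact: asboolb. Qed.

Lemma measurable_label_open e : measurable_fun setT (label_open e).
Proof.
apply: measurable_fun_ler; first exact: measurable_funP.
exact: measurableT_comp (measurable_envp e) _.
Qed.

Lemma label_cylinder t (T : pred (edge G)) (q : edge G -> R) :
  uniq t -> (forall e, 0 <= q e <= 1) ->
  (\int[P]_x (\prod_(e <- t) ((U e x <= q e) == T e)%:R)%:E =
   (\prod_(e <- t) (if T e then q e else 1 - q e))%:E)%E.
Proof.
move=> ut q01; case: perc => _ Uunif Uind _.
pose B e : set R := [set r | (r <= q e) == T e].
have mB e : measurable (B e).
  rewrite [B e](_ : _ = (fun r => r <= q e) @^-1` [set T e]); last first.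
    by apply/seteqP; split=> r /= /eqP.
  rewrite -[X in measurable X]setTI; apply: measurable_fun_ler => //.
have <- : P (\bigcap_(e in [set` t]) (U e @^-1` B e)) =
    (\prod_(e <- t) (if T e then q e else 1 - q e))%:E.
  rewrite Uind// -prodEFin; apply: eq_bigr => e _.
  by rewrite -(uniform_prob_le (T e) (q01 e)) -(Uunif e _ (mB e)).
rewrite -[X in P X]setIT -integral_indic//; last first.
  apply: fin_bigcap_measurable; first exact: finite_seq.
  by move=> e _; rewrite -[X in measurable X]setTI; exact: measurable_funP.
apply: eq_integral => x _; congr EFin; rewrite indicE.
transitivity ((all (fun e => (U e x <= q e) == T e) t)%:R : R).
  elim: (t) => [|e t' IH]; first by rewrite big_nil.
  by rewrite big_cons IH /= -natrM mulnb.
congr (nat_of_bool _)%:R; apply/allP/idP; rewrite inE => h e et; exact: h.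
Qed.

(** Independence freezes the environment while the labels are integrated out; what remains is the
    cylinder probability for fixed parameters. *)
Lemma environment_cylinder (h : environment G -> R) t (T : pred (edge G)) :
  measurable_fun setT h -> (forall y, 0 <= h y) -> uniq t ->
  (\int[P]_x (h (p x) * \prod_(e <- t) (label_open e x == T e)%:R)%:E =
   \int[P]_x (h (p x) * \prod_(e <- t)
     (if T e then envp (p x) e else 1 - envp (p x) e))%:E)%E.
Proof.
move=> mh h0 ut; case: (perc) => _ _ _ pU.
have mUv : measurable_fun setT (fun x => (fun e => U e x) : product_space (edge G) R).
  by apply: measurable_to_product => e; exact: measurable_funP.
pose Uv : {mfun Om >-> product_space (edge G) R} :=
  HB.pack (fun x => (fun e => U e x) : product_space (edge G) R)
    (isMeasurableFun.Build _ _ _ _ _ mUv).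
pose f (z : environment G * product_space (edge G) R) : \bar R :=
  (h z.1 * \prod_(e <- t) ((z.2 e <= envp z.1 e) == T e)%:R)%:E.
have mf : measurable_fun setT f.
  apply/measurable_EFinP; apply: measurable_funM.
    exact: measurableT_comp mh measurable_fst.
  apply: measurable_prod => e _.
  apply: measurable_eqb.
  apply: measurable_fun_ler.
    exact: measurableT_comp (@measurable_coordinate _ _ _ e) measurable_snd.
  exact: measurableT_comp (@measurable_envp _ _ e) measurable_fst.
have f0 z : (0 <= f z)%E by rewrite lee_fin mulr_ge0// prodr_ge0.
have := @independent_integral _ _ _ P _ _ _ _ p Uv f pU mf f0.
rewrite /f /= => ->; apply: eq_integral => x _.
rewrite EFinM -(label_cylinder T ut (envp01 (p x))).
rewrite -ge0_integralZl ?lee_fin//.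
- apply/measurable_EFinP; apply: measurable_prod => e _.
  apply: measurable_eqb.
  by apply: measurable_fun_ler => //; exact: measurable_funP.
- by move=> y _; rewrite lee_fin prodr_ge0.
Qed.

Lemma opn_cons e s x : opn x `&` [set` e :: s] =
  if label_open e x then e |` (opn x `&` [set` s]) else opn x `&` [set` s].
Proof.
apply/seteqP; split=> f.
  move=> [fo]; rewrite /= in_cons => /predU1P[fe|fs].
    by move: fo; rewrite fe /open_edges /= -/(label_open e x) => ->; left.
  by case: ifP => _; [right|].
case: ifPn => [eo [->|[fo fs]]|_ [fo fs]]; split=> //=; rewrite in_cons ?eqxx ?fs ?orbT//.
Qed.

Lemma measurable_local (F : environment G -> set (edge G) -> R) s :
  (forall S, measurable_fun setT (F^~ S)) ->
  measurable_fun setT (fun x => F (p x) (opn x `&` [set` s])).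
Proof.
elim: s F => [|e s IH] F mF.
  under eq_fun => x do rewrite set_nil setI0.
  exact: measurableT_comp (mF set0) _.
rewrite (_ : (fun x => _) = (fun x => if label_open e x
    then (fun y S => F y (e |` S)) (p x) (opn x `&` [set` s])
    else F (p x) (opn x `&` [set` s]))); last first.
  by apply/funext => x; rewrite opn_cons; case: ifP.
apply: measurable_fun_ifT; first exact: measurable_label_open.
  by apply: (IH (fun y S => F y (e |` S))) => S.
exact: IH.
Qed.

Lemma measurable_bexp (F : environment G -> set (edge G) -> R) s :
  (forall S, measurable_fun setT (F^~ S)) ->
  measurable_fun setT (fun y => bexp (envp y) s (F y)).
Proof.
elim: s F => [|e s IH] F mF /=; first exact: mF.
apply: measurable_funD; apply: measurable_funM.
- exact: measurable_envp.
- by apply: (IH (fun y S => F y (e |` S))) => S.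
- by apply: measurable_funB => //; exact: measurable_envp.
- exact: IH.
Qed.

(** The list [t] with prescribed states [T] makes the induction go through: splitting on the state
    of the first edge of [s] moves that edge to [t], until only a cylinder event is left. *)
Lemma sampling_given (F : environment G -> set (edge G) -> R) s t
    (T : pred (edge G)) :
  (forall S, measurable_fun setT (F^~ S)) -> (forall y S, 0 <= F y S) ->
  uniq (t ++ s) ->
  (\int[P]_x (F (p x) (opn x `&` [set` s]) *
      \prod_(e <- t) (label_open e x == T e)%:R)%:E =
   \int[P]_x (bexp (envp (p x)) s (F (p x)) *
      \prod_(e <- t) (if T e then envp (p x) e else 1 - envp (p x) e))%:E)%E.
Proof.
elim: s F t T => [|e s IH] F t T mF F0 uts.
  under eq_integral => x _ do rewrite set_nil setI0.
  rewrite cats0 in uts; exact: (environment_cylinder T (mF set0)).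
have ut : uniq ((e :: t) ++ s).
  by move: uts; rewrite -cat1s catA (perm_uniq (_ : perm_eq _ ((e :: t) ++ s)))//
    perm_cat2r cats1 perm_rcons.
have et : e \notin t.
  by move: ut => /= /andP[]; rewrite mem_cat negb_or => /andP[].
pose Te b : pred (edge G) := fun f => if f == e then b else T f.
have TeE b (H : edge G -> bool -> R) :
    \prod_(f <- e :: t) H f (Te b f) = H e b * \prod_(f <- t) H f (T f).
  rewrite big_cons {1}/Te eqxx; congr (_ * _); apply: eq_big_seq => f ft.
  by rewrite /Te; case: eqP => // fe; move: et; rewrite -fe ft.
have mcyl b : measurable_fun setT
    (fun x => \prod_(f <- e :: t) (label_open f x == Te b f)%:R : R).
  apply: measurable_prod => f _.
  apply: measurable_eqb.
  exact: measurable_label_open.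
have mpar b : measurable_fun setT (fun x => \prod_(f <- e :: t)
    (if Te b f then envp (p x) f else 1 - envp (p x) f)).
  apply: measurable_prod => f _; have mp : measurable_fun setT (fun x => envp (p x) f).
    exact: measurableT_comp (@measurable_envp _ _ f) _.
  by case: (Te b f) => //; exact: measurable_funB.
have par0 b x f : 0 <= (if Te b f then envp (p x) f else 1 - envp (p x) f).
  by have /andP[? ?] := envp01 (p x) f; case: ifP => _ //; rewrite subr_ge0.
pose F1 := fun y S => F y (e |` S).
have mF1 S : measurable_fun setT (F1^~ S) by exact: mF.
have F10 y S : 0 <= F1 y S by exact: F0.
transitivity (\int[P]_x ((F1 (p x) (opn x `&` [set` s]) *
      \prod_(f <- e :: t) (label_open f x == Te true f)%:R)%:E +
    (F (p x) (opn x `&` [set` s]) *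
      \prod_(f <- e :: t) (label_open f x == Te false f)%:R)%:E))%E.
  apply: eq_integral => x _; rewrite -EFinD; congr EFin.
  rewrite !(TeE _ (fun f b => (label_open f x == b)%:R)) opn_cons.
  by case: (label_open e x); rewrite /= ?eqxx ?mul0r ?mulr0 ?mul1r ?addr0 ?add0r.
rewrite ge0_integralD//; last 4 first.
- by move=> x _; rewrite lee_fin mulr_ge0// prodr_ge0.
- by apply/measurable_EFinP; apply: measurable_funM => //; exact: measurable_local.
- by move=> x _; rewrite lee_fin mulr_ge0// prodr_ge0.
- by apply/measurable_EFinP; apply: measurable_funM => //; exact: measurable_local.
rewrite !IH// -ge0_integralD//; last 4 first.
- move=> x _; rewrite lee_fin mulr_ge0//; last by apply: prodr_ge0 => f _; exact: par0.
  by apply: bexp_ge0 => [f|S]; [exact: envp01|exact: F10].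
- apply/measurable_EFinP; apply: measurable_funM => //.
  exact: measurableT_comp (measurable_bexp _ mF1) _.
- move=> x _; rewrite lee_fin mulr_ge0//; last by apply: prodr_ge0 => f _; exact: par0.
  by apply: bexp_ge0 => [f|S]; [exact: envp01|exact: F0].
- apply/measurable_EFinP; apply: measurable_funM => //.
  exact: measurableT_comp (measurable_bexp _ mF) _.
apply: eq_integral => x _; rewrite -EFinD; congr EFin.
rewrite !(TeE _ (fun f b => if b then envp (p x) f else 1 - envp (p x) f)) /=.
rewrite /F1; ring.
Qed.

Lemma sampling (F : environment G -> set (edge G) -> R) s :
  (forall S, measurable_fun setT (F^~ S)) -> (forall y S, 0 <= F y S) ->
  uniq s ->
  (\int[P]_x (F (p x) (opn x `&` [set` s]))%:E =
   \int[P]_x (bexp (envp (p x)) s (F (p x)))%:E)%E.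
Proof.
move=> mF F0 us; have := @sampling_given F s [::] xpredT mF F0 us.
by under eq_integral => x _ do rewrite big_nil mulr1;
   under [X in _ = X -> _]eq_integral => x _ do rewrite big_nil mulr1.
Qed.

End Sampling.

Lemma bexp_map (R : realType) (E E' : choiceType) (g : E -> E') (q : E' -> R)
    (s : seq E) (f : set E -> R) : injective g ->
  bexp q (map g s) (fun S => f (g @^-1` S)) = bexp (q \o g) s f.
Proof.
move=> ginj; elim: s f => [//|e s IH] f /=.
have -> : (fun S => f (g @^-1` (g e |` S))) = (fun S => f (e |` g @^-1` S)).
  apply/funext => S; congr f; apply/seteqP; split=> x [|]; try by right.
    by move=> /ginj ->; left.
  by move=> ->; left.
by rewrite (IH (fun S => f (e |` S))) IH.
Qed.

Lemma measurable_sqrt_div d (T : measurableType d) (R : realType) (h k : T -> R) :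
  (forall y, 0 <= k y) -> measurable_fun setT h -> measurable_fun setT k ->
  measurable_fun setT (fun y => Num.sqrt (h y / k y)).
Proof.
move=> k0 mh mk; apply: (measurableT_comp (f := @Num.sqrt R)).
  by apply: continuous_measurable_fun; exact: sqrt_continuous.
apply: measurable_funM => //.
rewrite (_ : (fun y => (k y)^-1) = (fun y => k y `^ (-1))).
  exact: (measurableT_comp (measurable_powR (-1)) mk).
by apply/funext => y; rewrite powR_inv1.
Qed.

(** * Expectations against one signed part of the increment *)

Section OddsExpectation.
Variables (R : realType) (G : weighted_graph R).
Variables (mu : probability (environment G) R).
Context d (Om : measurableType d) (P : probability Om R).
Variables (p : {RV P >-> environment G}) (U : edge G -> {RV P >-> R}).
Hypothesis perc : percolation_in_environment p U mu.
Implicit Types (e : edge G) (s : seq (edge G)) (x : Om) (sg : bool)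
  (f : set (edge G) -> R).

Local Notation opn := (open_edges p U).

Lemma measurable_odds sg b e : measurable_fun setT (fun y => odds sg b (envp y e)).
Proof.
have m1 := @measurable_envp R G e.
have m2 : measurable_fun setT (fun y => 1 - envp y e) by exact: measurable_funB.
rewrite /odds; case: (sg == b) => //; case: b; apply: measurable_sqrt_div => // y.
  by have /andP[] := envp01 y e.
by have /andP[_ ?] := envp01 y e; rewrite subr_ge0.
Qed.

Definition edge_odds sg e x : R := odds sg (label_open p U e x) (envp (p x) e).

Lemma edge_odds_ge0 sg e x : 0 <= edge_odds sg e x.
Proof. exact: odds_ge0. Qed.

Lemma measurable_edge_odds sg e : measurable_fun setT (edge_odds sg e).
Proof.
rewrite (_ : edge_odds sg e = fun x => if label_open p U e x
    then odds sg true (envp (p x) e) else odds sg false (envp (p x) e)).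
  apply: measurable_fun_ifT; first exact: measurable_label_open.
    exact: measurableT_comp (measurable_odds _ _ e) _.
  exact: measurableT_comp (measurable_odds _ _ e) _.
by apply/funext => x; rewrite /edge_odds; case: label_open.
Qed.

Definition odds_expectation sg e f : \bar R :=
  (\int[P]_x (edge_odds sg e x * f (opn x))%:E)%E.

Lemma measurable_keep_below f N : measurable_fun setT (fun x => f (keep_below (opn x) N)).
Proof. exact: (@measurable_local _ _ _ _ P p U (fun _ => f)). Qed.

Lemma measurable_stable f : stable f -> measurable_fun setT (fun x => f (opn x)).
Proof.
move=> fst; apply: (measurable_fun_cvg (h := fun N x => f (keep_below (opn x) N))).
  by move=> N; exact: measurable_keep_below.
by move=> x _; apply: cvg_near_cst; exact: fst.
Qed.

Lemma edge_odds_sampling sg e s f : (forall S, 0 <= f S) -> uniq s -> e \in s ->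
  (\int[P]_x (edge_odds sg e x * f (opn x `&` [set` s]))%:E =
   \int[P]_x (bexp (envp (p x)) s
     (fun S => odds sg `[<S e>] (envp (p x) e) * f S))%:E)%E.
Proof.
move=> f0 us es.
rewrite -(sampling perc (F := fun y S => odds sg `[<S e>] (envp y e) * f S))//.
- apply: eq_integral => x _; rewrite /edge_odds -open_edgesE; congr (odds _ _ _ * _)%:E.
  by apply/asbool_equiv_eq; split=> [|[]].
- by move=> S; apply: measurable_funM => //; exact: measurable_odds.
- by move=> y S; rewrite mulr_ge0// odds_ge0.
Qed.

Lemma odds_expectation_cst_le1 sg e : (odds_expectation sg e (fun=> 1%R) <= 1)%E.
Proof.
rewrite /odds_expectation.
rewrite (edge_odds_sampling (s := [:: e]) sg (f := fun=> 1))//; last exact: mem_head.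
have -> : (1 = \int[P]_x 1)%E.
  rewrite integral_cst// mul1e; exact/esym/probability_setT.
apply: ge0_le_integral => //.
- move=> x _; rewrite lee_fin bexp_ge0// => [f|S]; first exact: envp01.
  by rewrite mulr1 odds_ge0.
- apply/measurable_EFinP.
  apply: (measurableT_comp (f := fun y => bexp (envp y) [:: e]
    (fun S => odds sg `[<S e>] (envp y e) * 1))) => //.
  apply: measurable_bexp => S; apply: measurable_funM => //; exact: measurable_odds.
move=> x _; rewrite lee_fin /= !mulr1.
rewrite asboolT; last by left.
rewrite asboolF//; set q := envp (p x) e.
have q01 : 0 <= q <= 1 := envp01 _ _.
have [m1 m2] := mul_odds q01.
have s1 : Num.sqrt (q * (1 - q)) <= 1.
  rewrite -[leRHS]sqrtr1 ler_wsqrtr//; case/andP: q01 => q0 q1.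
  by rewrite mulr_ile1 ?subr_ge0// gerBl.
by case: sg; rewrite ?m1 ?m2 {1}/odds /= mulr0 ?addr0 ?add0r ?m1 ?m2.
Qed.

Lemma odds_expectation_ge0 sg e f : (forall S, 0 <= f S) ->
  (0 <= odds_expectation sg e f)%E.
Proof.
by move=> f0; apply: integral_ge0 => x _; rewrite lee_fin mulr_ge0// edge_odds_ge0.
Qed.

Lemma odds_expectation_le sg e f (B : R) : stable f -> (forall S, 0 <= f S <= B) ->
  (odds_expectation sg e f <= B%:E)%E.
Proof.
move=> fst f01; have B0 : 0 <= B by have /andP[] := f01 set0; exact: le_trans.
apply: (@le_trans _ _ (B%:E * odds_expectation sg e (fun=> 1%R))%E); last first.
  by rewrite -[leRHS]mule1 lee_wpmul2l// ?lee_fin// odds_expectation_cst_le1.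
rewrite /odds_expectation -ge0_integralZl_EFin//; last 2 first.
- by move=> x _; rewrite mulr1 lee_fin edge_odds_ge0.
- by apply/measurable_EFinP; apply: measurable_funM => //; exact: measurable_edge_odds.
have mo := measurable_edge_odds sg e.
apply: ge0_le_integral => //.
- by move=> x _; have /andP[? _] := f01 (opn x); rewrite lee_fin mulr_ge0// edge_odds_ge0.
- by apply/measurable_EFinP; apply: measurable_funM => //; exact: measurable_stable.
- by apply/measurable_EFinP; apply: measurable_funM => //; apply: measurable_funM.
- move=> x _; rewrite -EFinM lee_fin mulr1 mulrC ler_wpM2r ?edge_odds_ge0//.
  by have /andP[] := f01 (opn x).
Qed.

Lemma odds_expectation_fin_num sg e f (B : R) : stable f ->
  (forall S, 0 <= f S <= B) -> odds_expectation sg e f \is a fin_num.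
Proof.
move=> fst f01; rewrite ge0_fin_numE; last first.
  by apply: odds_expectation_ge0 => S; have /andP[] := f01 S.
exact: le_lt_trans (odds_expectation_le sg e fst f01) (ltry _).
Qed.

(** The odds are unbounded as the parameter approaches 0 or 1, but their mean is at most 1, so
    [B * edge_odds sg e] is an integrable dominating function. *)
Lemma odds_expectation_cvg sg e (fN : nat -> set (edge G) -> R) f (B : R) :
  (forall N, measurable_fun setT (fun x => fN N (opn x))) ->
  (forall N S, 0 <= fN N S <= B) ->
  (forall S, \forall N \near \oo, fN N S = f S) ->
  odds_expectation sg e (fN N) @[N --> \oo] --> odds_expectation sg e f.
Proof.
move=> mfN f01 fNf; have mo := measurable_edge_odds sg e.
have B0 : 0 <= B by have /andP[] := f01 0%N set0; exact: le_trans.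
have mf : measurable_fun setT (fun x => f (opn x)).
  apply: (measurable_fun_cvg mfN) => x _; apply: cvg_near_cst; exact: fNf.
have [] // := @dominated_convergence _ _ _ P setT measurableT
  (fun N x => (edge_odds sg e x * fN N (opn x))%:E)
  (fun x => (edge_odds sg e x * f (opn x))%:E) (fun x => (B * edge_odds sg e x)%:E).
- by move=> N; apply/measurable_EFinP; exact: measurable_funM.
- by apply/measurable_EFinP; exact: measurable_funM.
- apply: aeW => x _; apply: cvg_near_cst.
  by apply: filterS (fNf (opn x)) => N ->.
- under eq_fun do rewrite EFinM; apply: integrableZl => //.
  apply/integrableP; split; first exact/measurable_EFinP.
  under eq_integral do rewrite gee0_abs ?lee_fin ?edge_odds_ge0//.
  apply: le_lt_trans (ltry 1); apply: le_trans (odds_expectation_cst_le1 sg e).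
  by rewrite le_eqVlt; apply/orP; left; apply/eqP/eq_integral => x _; rewrite mulr1.
- apply: aeW => x N _; have /andP[g0 g1] := f01 N (opn x).
  by rewrite gee0_abs ?lee_fin ?mulr_ge0 ?edge_odds_ge0// mulrC ler_wpM2r ?edge_odds_ge0.
Qed.

Lemma odds_expectation_below_cvg sg e f (B : R) : stable f ->
  (forall S, 0 <= f S <= B) ->
  odds_expectation sg e (fun S => f (keep_below S N)) @[N --> \oo] -->
  odds_expectation sg e f.
Proof.
move=> fst f01; apply: (odds_expectation_cvg (B := B)) => //.
by move=> N; exact: measurable_keep_below.
Qed.

Section Invariance.
Variables (Gamma : set (graph_map G)) (gam : graph_map G).
Hypotheses (Gamma_sub : Gamma `<=` @Aut R G) (mu_inv : invariant_law Gamma mu).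
Hypothesis gamP : Gamma gam.

Lemma environment_shift (h : environment G -> R) : measurable_fun setT h ->
  (forall y, 0 <= h y) ->
  (\int[P]_x (h (fun e => p x (on_edge gam e)))%:E = \int[P]_x (h (p x))%:E)%E.
Proof.
move=> mh h0; case: perc => pmu _ _ _.
pose shift (y : environment G) : environment G := fun e => y (on_edge gam e).
have mshift : measurable_fun setT shift.
  apply: measurable_to_product => e; exact: measurable_coordinate.
have mEh : measurable_fun setT (EFin \o h) by exact/measurable_EFinP.
rewrite -(@ge0_integral_distribution _ _ _ _ _ P p (EFin \o h \o shift))//; last 2 first.
- exact: measurableT_comp mEh mshift.
- by move=> y; rewrite /= lee_fin.
rewrite -(@ge0_integral_distribution _ _ _ _ _ P p (EFin \o h))//.
rewrite -[LHS](@ge0_integral_pushforward _ _ _ _ _ shift mshift _ setT (EFin \o h))//;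
  last first.
  by move=> y _; rewrite /= lee_fin.
apply: eq_measure_integral => A mA _.
have mA' : measurable (shift @^-1` A).
  by rewrite -[X in measurable X]setTI; exact: mshift.
have := mu_inv gamP mA; rewrite -(pmu _ mA) -(pmu _ mA'); exact.
Qed.

(** After sampling, only the environment is random, and its law is invariant. The enumeration of the
    edges is not invariant, so one side is truncated to the first [N] edges and the other to their
    images; both converge by dominated convergence. *)
Lemma odds_expectation_on sg e f (B : R) : stable f -> (forall S, 0 <= f S <= B) ->
  odds_expectation sg (on_edge gam e) (fun S => f (on_edge gam @^-1` S)) =
  odds_expectation sg e f.
Proof.
move=> fst f01; have ginj := on_edge_inj (Gamma_sub gamP).
have f0 S : 0 <= f S by have /andP[] := f01 S.
pose g := on_edge gam.
have mapE S N : g @^-1` (S `&` [set` map g (edges_below G N)]) = keep_below (g @^-1` S) N.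
  apply/seteqP; split=> f' [/= Sf]; last by move=> f'N; split=> //=; exact: map_f.
  by rewrite (mem_map ginj).
have lim : odds_expectation sg (g e) (fun S => f (keep_below (g @^-1` S) N)) @[N --> \oo] -->
    odds_expectation sg (g e) (fun S => f (g @^-1` S)).
  apply: (odds_expectation_cvg (B := B)) => //.
  move=> N; under eq_fun do rewrite -mapE.
  exact: (@measurable_local _ _ _ _ P p U (fun _ S => f (g @^-1` S))).
have lim' := odds_expectation_below_cvg (sg := sg) (e := e) fst f01.
apply: (cvg_unique _ lim) => //; apply: cvg_trans lim'; apply: near_eq_cvg.
near=> N; have eN : e \in edges_below G N by near: N; exact: near_edges_below.
have uN := edges_below_uniq G N.
rewrite /odds_expectation [LHS](edge_odds_sampling sg f0 uN eN).
under [RHS]eq_integral do rewrite -mapE.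
rewrite (edge_odds_sampling sg (e := g e) (f := fun S => f (g @^-1` S)))//; last 2 first.
- by rewrite map_inj_uniq.
- exact: map_f.
rewrite -(environment_shift (h := fun y => bexp (envp y) (edges_below G N)
    (fun S => odds sg `[<S e>] (envp y e) * f S))).
- apply: eq_integral => x _; congr EFin.
  apply/esym; exact: (bexp_map (envp (p x)) (edges_below G N)
    (fun S => odds sg `[<S e>] (envp (p x) (g e)) * f S) ginj).
- apply: measurable_bexp => S; apply: measurable_funM => //; exact: measurable_odds.
- by move=> y; apply: bexp_ge0 => [f'|S]; [exact: envp01|rewrite mulr_ge0// odds_ge0].
Unshelve. all: by end_near. Qed.

End Invariance.

End OddsExpectation.

(** * Choice of the exploration weight *)

Section BudgetSums.
Variable R : realType.
Implicit Types (n L k c : nat).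

(* Any nonincreasing weight can be used in the exploration.  This one is [c ^ -1/2]
   up to [n] and then decays like [c ^ -3/2], so that both [budget] against the
   tail [c ^ -theta] and its dual, in the sense of [capped_sqr_le], have the
   right order in [n]. *)
Definition budget n L c : R :=
  if (c <= L)%N then
    if (c <= n)%N then (Num.sqrt c%:R)^-1 else n%:R / (c%:R * Num.sqrt c%:R)
  else 0.

(** Layer-cake form: its expectation is a finite combination of the tail probabilities of [k]. *)
Definition layers M (a : nat -> R) k : R :=
  \sum_(1 <= c < M.+1) a c * (c <= k)%N%:R.

Definition dual_budget n c : R := (Num.sqrt c%:R)^-1 / n%:R ^+ 2.

Lemma budget_ge0 n L c : 0 <= budget n L c.
Proof.
rewrite /budget; case: ifP => // _; case: ifP => _; first by rewrite invr_ge0 sqrtr_ge0.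
by rewrite divr_ge0// mulr_ge0// sqrtr_ge0.
Qed.

Lemma dual_budget_ge0 n c : 0 <= dual_budget n c.
Proof. by rewrite divr_ge0// invr_ge0 sqrtr_ge0. Qed.

Lemma sqrtn_gt0 c : (0 < c)%N -> 0 < Num.sqrt c%:R :> R.
Proof. by move=> c0; rewrite sqrtr_gt0 ltr0n. Qed.

Lemma sqrtn_sqr c : Num.sqrt c%:R ^+ 2 = c%:R :> R.
Proof. by rewrite sqr_sqrtr. Qed.

Lemma budget_dec n L c : (0 < c)%N -> budget n L c.+1 <= budget n L c.
Proof.
move=> c0; have s0 := sqrtn_gt0 c0; have s1 := @sqrtn_gt0 c.+1 isT.
have ss : Num.sqrt c%:R <= Num.sqrt c.+1%:R :> R by rewrite ler_wsqrtr// ler_nat.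
rewrite {1}/budget; case: ifPn => cL; last exact: budget_ge0.
rewrite /budget (ltnW cL); case: ifPn => cn; first by rewrite (ltnW cn) lef_pV2.
case: ifPn => cn'.
  have -> : c = n by apply/eqP; rewrite eqn_leq cn' leqNgt.
  have n0 : (0 < n)%N by apply: leq_trans cn'.
  have sn := sqrtn_gt0 n0; have sn1 := @sqrtn_gt0 n.+1 isT.
  rewrite ler_pdivrMr ?mulr_gt0 ?ltr0n// mulrC -ler_pdivrMr ?invr_gt0// invrK.
  rewrite ler_pM ?sqrtr_ge0// ?ler_nat// ler_wsqrtr// ler_nat//.
rewrite ler_wpM2l// lef_pV2 ?posrE ?mulr_gt0 ?ltr0n//.
by rewrite ler_pM ?sqrtr_ge0// ler_nat.
Qed.

Lemma sqrt_le_sum k : Num.sqrt k%:R <= \sum_(1 <= c < k.+1) (Num.sqrt c%:R)^-1 :> R.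
Proof.
elim: k => [|k IH]; first by rewrite big_geq// sqrtr0.
rewrite big_nat_recr//=; apply: le_trans (lerD IH (lexx _)).
have s1 := @sqrtn_gt0 k.+1 isT.
rewrite -lerBlDl -[leRHS]div1r ler_pdivlMr// mulrBl -expr2 sqrtn_sqr -natr1.
rewrite lerBlDr addrC lerD2l nat1r -[leLHS]sqrtn_sqr expr2 ler_wpM2l ?sqrtr_ge0//.
by rewrite ler_wsqrtr// ler_nat.
Qed.

Lemma layers_ge0 M a k : (forall c, 0 <= a c) -> 0 <= layers M a k.
Proof. by move=> a0; rewrite sumr_ge0// => c _; rewrite mulr_ge0. Qed.

Lemma layers_cumul L (a : nat -> R) k : (forall c, (L < c)%N -> a c = 0) ->
  \sum_(1 <= c < k.+1) a c = layers L a k.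
Proof.
move=> aL; rewrite /layers.
have cond M : \sum_(1 <= c < M.+1) a c * (c <= k)%N%:R =
    \sum_(1 <= c < M.+1 | (c <= k)%N) a c.
  rewrite [RHS]big_mkcond; apply: eq_bigr => c _.
  by case: ifP => _; rewrite ?mulr1 ?mulr0.
have [kL|Lk] := leqP k L.
  rewrite cond [RHS](big_cat_nat _ (n := k.+1))//= [X in _ + X]big_nat_cond.
  rewrite [X in _ + X]big1 ?addr0; last first.
    by move=> c /andP[/andP[kc _]]; rewrite leqNgt kc.
  rewrite big_nat [RHS]big_nat_cond; apply: eq_bigl => c.
  by case: (1 <= c)%N => //=; rewrite ltnS andbb.
rewrite (big_cat_nat _ (n := L.+1))//=; last by lia.
rewrite [X in _ + X]big_nat_cond [X in _ + X]big1 ?addr0; last first.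
  by move=> c /andP[/andP[Lc _] _]; exact: aL.
rewrite [LHS]big_nat [RHS]big_nat; apply: eq_bigr => c /andP[_ cL].
by rewrite (_ : (c <= k)%N) ?mulr1//; lia.
Qed.

(** The layer sum is at least [sqrt (min k n) / n ^ 2]. For [k <= n] this gives exactly [1 / n ^ 2];
    for [n < k <= L] the product is at least [1 / (k * sqrt k * sqrt n)], which exceeds
    [1 / k ^ 2]. *)
Lemma capped_sqr_le n L k : (0 < n)%N ->
  (capped R n L k / k%:R) ^+ 2 <= budget n L k * layers n (dual_budget n) k.
Proof.
move=> n0; have lay0 := layers_ge0 n k (dual_budget_ge0 n).
rewrite {1}/capped; case: ifPn => [/andP[k0 kL]|_]; last first.
  by rewrite mul0r expr0n mulr_ge0// budget_ge0.
have n0' : 0 < n%:R :> R by rewrite ltr0n.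
have k0' : 0 < k%:R :> R by rewrite ltr0n.
have sk := sqrtn_gt0 k0; have sn := sqrtn_gt0 n0.
have lay : Num.sqrt (minn k n)%:R / n%:R ^+ 2 <= layers n (dual_budget n) k.
  have -> : layers n (dual_budget n) k =
      (\sum_(1 <= c < (minn k n).+1) (Num.sqrt c%:R)^-1) / n%:R ^+ 2.
    rewrite mulr_suml /layers (big_cat_nat _ (n := (minn k n).+1))//=; last by lia.
    rewrite [X in _ + X]big_nat_cond [X in _ + X]big1 ?addr0; last first.
      move=> c /andP[/andP[kc cn] _]; rewrite (_ : (c <= k)%N = false) ?mulr0//.
      by apply/negbTE; rewrite -ltnNge; lia.
    rewrite big_nat [RHS]big_nat; apply: eq_bigr => c /andP[_ ck].
    by rewrite (_ : (c <= k)%N) ?mulr1//; lia.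
  by rewrite ler_wpM2r ?invr_ge0 ?sqr_ge0// sqrt_le_sum.
apply: le_trans (ler_wpM2l (budget_ge0 n L k) lay).
rewrite /budget kL; have [kn|nk] := leqP k n.
  rewrite mulrA mulVf ?gt_eqF// mul1r.
  by rewrite mulrAC divff ?gt_eqF// mul1r exprVn.
rewrite divff ?gt_eqF// mul1r.
have -> : n%:R / (k%:R * Num.sqrt k%:R) * (Num.sqrt n%:R / n%:R ^+ 2) =
    (k%:R * Num.sqrt k%:R * Num.sqrt n%:R)^-1 :> R.
  rewrite -{1 3}(sqrtn_sqr n); field.
  by rewrite !gt_eqF.
rewrite exprVn lef_pV2 ?posrE ?exprn_gt0 ?mulr_gt0// expr2 -mulrA ler_pM2l//.
rewrite -[leRHS]sqrtn_sqr expr2 ler_pM2l// ler_wsqrtr// ler_nat; exact: ltnW.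
Qed.

(** Pointwise substitute for Cauchy-Schwarz; the free parameter [l] is optimised only after all
    expectations and limits have been taken. *)
Lemma weighted_amgm (a b f y l : R) : 0 <= a -> 0 <= b -> f ^+ 2 <= a * b -> 0 < l ->
  f * y <= l / 2 * (a * y ^+ 2) + b / (2 * l).
Proof.
move=> a0 b0 fab l0.
have rhs0 : 0 <= l / 2 * (a * y ^+ 2) + b / (2 * l).
  apply: addr_ge0; last by rewrite divr_ge0// mulr_ge0// ltW.
  by apply: mulr_ge0; [lra|rewrite mulr_ge0// sqr_ge0].
have [fy|fy] := leP (f * y) 0; first exact: le_trans rhs0.
rewrite -ler_sqr ?nnegrE ?(ltW fy)// exprMn.
apply: (@le_trans _ _ (a * b * y ^+ 2)); first by rewrite ler_wpM2r// sqr_ge0.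
rewrite -subr_ge0.
have -> : (l / 2 * (a * y ^+ 2) + b / (2 * l)) ^+ 2 - a * b * y ^+ 2 =
    (l / 2 * (a * y ^+ 2) - b / (2 * l)) ^+ 2 by field; rewrite gt_eqF.
exact: sqr_ge0.
Qed.

Section Power.
Variables (A theta : R).
Hypotheses (A0 : 0 <= A) (theta_ge0 : 0 <= theta) (theta_lt : theta < 1 / 2).
Let r : R := 1 / 2 - theta.

Let r_gt0 : 0 < r. Proof. by rewrite subr_gt0. Qed.

Let r_lt1 : r < 1.
Proof. by rewrite /r; have := theta_ge0; lra. Qed.

(* By Young's inequality, [(1 - 1/c) ^ r <= 1 - r/c]. *)
Lemma powR_step c : (0 < c)%N ->
  r * c%:R `^ (r - 1) <= c%:R `^ r - c.-1%:R `^ r.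
Proof.
case: c => // k _ /=.
have k1 : 0 < k.+1%:R :> R by rewrite ltr0n.
have -> : k.+1%:R `^ (r - 1) = k.+1%:R `^ r / k.+1%:R :> R.
  by rewrite powRD ?pnatr_eq0 ?implybT// powR_inv1.
have [->|k0] := posnP k.
  by rewrite powR1 powR0 ?gt_eqF// subr0 divr1 mulr1 ltW.
have k0' : 0 < k%:R :> R by rewrite ltr0n.
have -> : k%:R = k.+1%:R * (k%:R / k.+1%:R) :> R by field; rewrite gt_eqF.
rewrite powRM ?divr_ge0//.
have bern : (k%:R / k.+1%:R) `^ r <= 1 - r / k.+1%:R :> R.
  have r1 : 0 < 1 - r by rewrite subr_gt0.
  have := @conjugate_powR R ((k%:R / k.+1%:R) `^ r) 1 r^-1 (1 - r)^-1
    (powR_ge0 _ _) ler01.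
  rewrite !invr_gt0 => /(_ r_gt0 r1); rewrite !invrK mulr1 -powRrM divff ?gt_eqF//.
  rewrite powRr1 ?divr_ge0// powR1 mul1r => /(_ (subrKC _ _)) /le_trans; apply.
  by rewrite le_eqVlt; apply/orP; left; apply/eqP; rewrite -natr1; field; rewrite natr1 gt_eqF.
rewrite -subr_ge0.
have -> : k.+1%:R `^ r - k.+1%:R `^ r * (k%:R / k.+1%:R) `^ r -
    r * (k.+1%:R `^ r / k.+1%:R) =
  k.+1%:R `^ r * (1 - r / k.+1%:R - (k%:R / k.+1%:R) `^ r) by field; rewrite gt_eqF.
by rewrite mulr_ge0 ?powR_ge0// subr_ge0.
Qed.

Lemma sum_powR_le k : \sum_(1 <= c < k.+1) c%:R `^ (r - 1) <= k%:R `^ r / r.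
Proof.
rewrite ler_pdivlMr// mulrC mulr_sumr.
elim: k => [|k IH]; first by rewrite big_geq// powR_ge0.
rewrite big_nat_recr//=; apply: le_trans (lerD IH (powR_step (isT : (0 < k.+1)%N))) _.
by rewrite subrKC.
Qed.

Lemma inv_sqrt_powR c : (0 < c)%N ->
  (Num.sqrt c%:R)^-1 * (A * c%:R `^ (- theta)) = A * c%:R `^ (r - 1).
Proof.
move=> c0; have c0' : 0 < c%:R :> R by rewrite ltr0n.
rewrite -powR12_sqrt// -powRN mulrCA -powRD; last first.
  by rewrite pnatr_eq0 -lt0n c0 implybT.
by congr (_ * _ `^ _); rewrite /r; field.
Qed.

Lemma dual_budget_sum n : (0 < n)%N ->
  \sum_(1 <= c < n.+1) dual_budget n c * (A * c%:R `^ (- theta)) <=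
  A * (n%:R `^ r / r) / n%:R ^+ 2.
Proof.
move=> n0; have n0' : 0 < n%:R :> R by rewrite ltr0n.
rewrite ler_pdivlMr ?exprn_gt0// mulr_suml.
apply: le_trans (ler_wpM2l A0 (sum_powR_le n)).
rewrite mulr_sumr !big_nat; apply: ler_sum => c /andP[c0 _].
rewrite -inv_sqrt_powR// /dual_budget.
by rewrite le_eqVlt; apply/orP; left; apply/eqP; field; rewrite !gt_eqF ?sqrtn_gt0.
Qed.

(** Up to [n] the terms are [A * c ^ (r - 1)]. Beyond [n], [c ^ (- theta)] is at most
    [n ^ (- theta)] and the sum of [c ^ (-3/2)] telescopes. Each range contributes at most
    [A * n ^ r / r]. *)
Lemma budget_sum n L : (0 < n)%N ->
  \sum_(1 <= c < L.+1) budget n L c * (A * c%:R `^ (- theta)) <=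
  2 * (A * (n%:R `^ r / r)).
Proof.
move=> n0; have n0' : 0 < n%:R :> R by rewrite ltr0n.
have sn := sqrtn_gt0 n0.
set a := A * (n%:R `^ r / r); have a0 : 0 <= a.
  by rewrite mulr_ge0// divr_ge0 ?powR_ge0// ltW.
pose b (c : nat) : R := (Num.sqrt c%:R)^-1 * (A * c%:R `^ (- theta)).
have b0 c : 0 <= b c by rewrite mulr_ge0 ?invr_ge0 ?sqrtr_ge0// mulr_ge0// powR_ge0.
have small : \sum_(1 <= c < n.+1) b c <= a.
  apply: le_trans (ler_wpM2l A0 (sum_powR_le n)).
  by rewrite mulr_sumr !big_nat; apply: ler_sum => c /andP[c0 _]; rewrite -inv_sqrt_powR.
pose D : R := 2 * A * n%:R * n%:R `^ (- theta).
have D0 : 0 <= D by rewrite /D !mulr_ge0// powR_ge0.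
have tail m : (n <= m)%N ->
    \sum_(n.+1 <= c < m.+1) n%:R / (c%:R * Num.sqrt c%:R) * (A * c%:R `^ (- theta)) <=
    D * ((Num.sqrt n%:R)^-1 - (Num.sqrt m%:R)^-1).
  elim: m => [|m IH]; first by rewrite leqn0 => /eqP n00; rewrite n00 in n0.
  rewrite leq_eqVlt => /predU1P[<-|]; first by rewrite big_geq// subrr mulr0.
  rewrite ltnS => nm; rewrite big_nat_recr//=.
  apply: le_trans (lerD (IH nm) (lexx _)) _.
  have m0 : (0 < m)%N by exact: leq_trans nm.
  have sm := sqrtn_gt0 m0; have sm1 := @sqrtn_gt0 m.+1 isT.
  have mm1 : Num.sqrt m%:R <= Num.sqrt m.+1%:R :> R by rewrite ler_wsqrtr// ler_nat.
  set x := Num.sqrt m%:R in sm mm1 *; set y := Num.sqrt m.+1%:R in sm1 mm1 *.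
  rewrite -lerBrDl [leRHS](_ : _ = D * (x^-1 - y^-1)); last by ring.
  have pw : m.+1%:R `^ (- theta) <= n%:R `^ (- theta) :> R.
    rewrite !powRN lef_pV2 ?posrE ?powR_gt0 ?ltr0n// ge0_ler_powR ?nnegrE//.
    by rewrite ler_nat leqW.
  have xy : y ^+ 2 = x ^+ 2 + 1 by rewrite !sqrtn_sqr natr1.
  (* Discrete form of the fact that [-2 * c ^ (-1/2)] is a primitive of [c ^ (-3/2)]. *)
  have step : (m.+1%:R * y)^-1 <= 2 * (x^-1 - y^-1).
    have -> : x^-1 - y^-1 = (x * y * (x + y))^-1.
      have /eqP yx1 : (y - x) * (y + x) == 1 by rewrite -subr_sqr xy addrC addKr.
      apply: (mulIf (x := x * y * (x + y))); first by rewrite !gt_eqF ?mulr_gt0 ?addr_gt0.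
      rewrite mulVf ?gt_eqF ?mulr_gt0 ?addr_gt0// -[RHS]yx1.
      by field; rewrite !gt_eqF.
    rewrite -(sqrtn_sqr m.+1) -/y -invf_div lef_pV2 ?posrE ?divr_gt0 ?mulr_gt0 ?addr_gt0//.
    rewrite ler_pdivrMr// (_ : x * y * (x + y) = y * (x * (x + y))); last by ring.
    rewrite (_ : y ^+ 2 * y * 2 = y * (y * (y + y))); last by ring.
    rewrite ler_pM2l//; apply: ler_pM; rewrite ?lerD2r//; first exact: ltW.
    by rewrite addr_ge0// ltW.
  have -> : n%:R / (m.+1%:R * y) * (A * m.+1%:R `^ (- theta)) =
    A * n%:R * (m.+1%:R `^ (- theta) * (m.+1%:R * y)^-1) by ring.
  rewrite (_ : D * _ = A * n%:R * (n%:R `^ (- theta) * (2 * (x^-1 - y^-1)))); last first.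
    by rewrite /D; ring.
  rewrite ler_wpM2l ?mulr_ge0// ler_pM ?powR_ge0// invr_ge0 mulr_ge0// ltW//.
have Dn : D * (Num.sqrt n%:R)^-1 <= a.
  have -> : D * (Num.sqrt n%:R)^-1 = A * n%:R `^ r * 2.
    rewrite (_ : r = 2^-1 + - theta); last by rewrite /r; field.
    rewrite powRD; last by rewrite pnatr_eq0 -lt0n n0 implybT.
    rewrite powR12_sqrt// /D; have := sqrtn_sqr n.
    set z := Num.sqrt n%:R in sn *; set u := n%:R `^ (- theta) => <-.
    by field; rewrite gt_eqF.
  (* The factor 2 is at most [1 / r], as [theta >= 0] gives [r <= 1 / 2]. *)
  rewrite /a mulrA ler_wpM2l ?mulr_ge0 ?powR_ge0//.
  by rewrite -[leLHS]invrK lef_pV2 ?posrE ?invr_gt0// /r; have := theta_ge0; lra.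
have [nL|Ln] := leqP n L; last first.
  apply: (@le_trans _ _ a); last by rewrite mulr_natl mulr2n lerDl.
  apply: le_trans small; rewrite [leRHS](big_cat_nat _ (n := L.+1))//=; last exact: ltnW.
  rewrite -[leLHS]addr0 lerD ?sumr_ge0//.
  rewrite !big_nat; apply: ler_sum => c /andP[_]; rewrite ltnS => cL.
  by rewrite /budget cL (leq_trans cL (ltnW Ln)).
rewrite (big_cat_nat _ (n := n.+1))//= mulr_natl mulr2n; apply: lerD.
  apply: le_trans small; rewrite !big_nat; apply: ler_sum => c /andP[_].
  by rewrite ltnS => cn; rewrite /budget (leq_trans cn nL) cn.
apply: le_trans Dn; apply: (@le_trans _ _ (D * ((Num.sqrt n%:R)^-1 - (Num.sqrt L%:R)^-1))).
  apply: le_trans (tail L nL); rewrite !big_nat; apply: ler_sum => c /andP[nc cL].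
  by move: cL; rewrite ltnS /budget => ->; rewrite leqNgt nc.
by rewrite ler_wpM2l// gerBl invr_ge0 sqrtr_ge0.
Qed.

End Power.
End BudgetSums.

(** * Cauchy-Schwarz along the exploration *)

Section TruncatedBalance.
Variables (R : realType) (G : weighted_graph R) (q : edge G -> R).
Hypothesis q01 : forall e, 0 <= q e <= 1.
Variables (n L : nat) (w : edge G -> R) (W2 l : R).
Hypotheses (n0 : (0 < n)%N) (l0 : 0 < l).
Hypothesis W2P : forall v (t : seq (edge G)), uniq t ->
  \sum_(e <- t) (incidence e v)%:R * w e ^+ 2 <= W2.

(** The difference of the two sums is the mean of [f k / k * Z]. The squared fluctuation is
    controlled by the exploration with [budget] as its weight, the remaining factor by the dual
    weight. Keeping [r] apart from [s] allows [s] to grow with [r] fixed. *)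
Lemma truncated_balance (s r : seq (edge G)) v :
  uniq s -> uniq r -> {subset r <= s} ->
  \sum_(e <- r) w e *
    bexp q s (fun S => odds true `[<S e>] (q e) * share n L e v S) <=
  \sum_(e <- r) w e *
    bexp q s (fun S => odds false `[<S e>] (q e) * share n L e v S) +
  l / 2 * (W2 * bexp q s (fun S => layers L (budget R n L) (csize (cluster S v)))) +
  bexp q s (fun S => layers n (dual_budget R n) (csize (cluster S v))) / (2 * l).
Proof.
move=> us ur rs.
(* Every edge of [s] must be explored, but only those of [r] may contribute to the martingale. *)
pose w' e := if e \in r then w e else 0.
have fluctE S K : fluct q w' s S K = \sum_(e <- r) w e *
    (odds true `[<S e>] (q e) - odds false `[<S e>] (q e)) * `[<touches K e>]%:R.
  rewrite /fluct; transitivity (\sum_(e <- s | e \in r) w e *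
    (odds true `[<S e>] (q e) - odds false `[<S e>] (q e)) * `[<touches K e>]%:R).
    by rewrite [RHS]big_mkcond; apply: eq_bigr => e _; rewrite /w'; case: ifP; rewrite ?mul0r.
  rewrite -big_filter; apply: perm_big; apply: uniq_perm => //; first exact: filter_uniq.
  by move=> e; rewrite mem_filter andb_idr// => /rs.
have W2P' u (t : seq (edge G)) : uniq t ->
    \sum_(e <- t) (incidence e u)%:R * w' e ^+ 2 <= W2.
  move=> ut; apply: le_trans (W2P u ut); apply: ler_sum => e _.
  by rewrite ler_wpM2l// /w'; case: ifP => // _; rewrite expr0n sqr_ge0.
have bound := cluster_fluct_bound q01 (budget_ge0 R n L) (@budget_dec R n L) W2P' v us.
pose phi S : R := capped R n L (csize (cluster S v)) / (csize (cluster S v))%:R.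
have main : bexp q s (fun S => phi S * fluct q w' s S (cluster S v)) <=
    l / 2 * (W2 * bexp q s (fun S => layers L (budget R n L) (csize (cluster S v)))) +
    bexp q s (fun S => layers n (dual_budget R n) (csize (cluster S v))) / (2 * l).
  apply: (@le_trans _ _ (l / 2 * bexp q s (fun S =>
      budget R n L (csize (cluster S v)) * fluct q w' s S (cluster S v) ^+ 2) +
    (2 * l)^-1 * bexp q s (fun S => layers n (dual_budget R n) (csize (cluster S v))))).
    rewrite -!bexpZ -bexpD; apply: bexp_le => // S _; rewrite [X in _ + X]mulrC.
    apply: weighted_amgm => //; first exact: budget_ge0.
      exact: layers_ge0 (dual_budget_ge0 R n).
    exact: capped_sqr_le.
  rewrite [X in _ + X]mulrC lerD2r ler_wpM2l ?divr_ge0 ?(ltW l0)//.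
  apply: le_trans bound _; rewrite le_eqVlt; apply/orP; left; apply/eqP.
  congr (_ * _); apply: eq_bexp => S _; apply: layers_cumul => c Lc.
  by rewrite /budget leqNgt Lc.
rewrite -addrA addrC -lerBlDr; apply: le_trans main.
rewrite -sumrB le_eqVlt; apply/orP; left; apply/eqP.
rewrite (@eq_bexp _ _ _ _ (fun S => phi S * fluct q w' s S (cluster S v))
  (fun S => \sum_(e <- r) (w e * (odds true `[<S e>] (q e) * share n L e v S) +
     (- w e) * (odds false `[<S e>] (q e) * share n L e v S)))).
  rewrite bexp_sum; apply: eq_bigr => e _; rewrite bexpD !bexpZ; ring.
move=> S _; rewrite fluctE mulr_sumr; apply: eq_bigr => e _.
rewrite /share -/(phi S); ring.
Qed.

End TruncatedBalance.

Section Balance.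
Variables (R : realType) (G : weighted_graph R).
Variables (mu : probability (environment G) R).
Context d (Om : measurableType d) (P : probability Om R).
Variables (p : {RV P >-> environment G}) (U : edge G -> {RV P >-> R}).
Hypothesis perc : percolation_in_environment p U mu.
Variables (o : vertex G) (tl : nat -> R).
Hypothesis tail : forall c : nat, (1 <= c)%N ->
  (P (cluster_ge p U o c) <= (tl c)%:E)%E.

Local Notation opn := (open_edges p U).

Lemma measurable_cluster_ge v c : measurable (cluster_ge p U v c).
Proof.
have st : stable (fun S => `[<(`I_c #<= cluster S v)%card>]%:R : R).
  by move=> S; apply: filterS (stable_card_ge c v S) => N ->.
have := @measurable_stable _ _ _ _ P p U _ st measurableT [set 1] (measurable_set1 1).
rewrite setTI (_ : _ @^-1` _ = cluster_ge p U v c)//.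
apply/seteqP; split=> x /=.
  by case: asboolP => // _ /eqP; rewrite eq_sym oner_eq0.
by move=> cK; rewrite asboolT.
Qed.

(** Truncation only shrinks the cluster, so the tail assumption applies uniformly in [N]. *)
Lemma layers_expectation M (a : nat -> R) N : (forall c, 0 <= a c) ->
  (\int[P]_x (layers M a (csize (cluster (keep_below (opn x) N) o)))%:E <=
   (\sum_(1 <= c < M.+1) a c * tl c)%:E)%E.
Proof.
move=> a0.
have mlarge c : measurable_fun setT
    (fun x => ((c <= csize (cluster (keep_below (opn x) N) o))%N%:R : R)).
  exact: (@measurable_keep_below _ _ _ _ P p U
    (fun S => (c <= csize (cluster S o))%N%:R) N).
under eq_integral do rewrite /layers -sumEFin.
rewrite ge0_integral_sum//; last 2 first.
- by move=> c; apply/measurable_EFinP; exact: measurable_funM.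
- by move=> c x _; rewrite lee_fin mulr_ge0.
rewrite -sumEFin big_nat [leRHS]big_nat; apply: lee_sum => c /andP[c1 _].
under eq_integral do rewrite EFinM.
rewrite ge0_integralZl_EFin//; last by apply/measurable_EFinP.
rewrite EFinM lee_wpmul2l ?lee_fin//; apply: le_trans (tail c1).
rewrite -[X in (_ <= P X)%E]setIT -integral_indic//; last exact: measurable_cluster_ge.
apply: ge0_le_integral => //.
- by apply/measurable_EFinP.
- by apply/measurable_EFinP/measurable_indic; exact: measurable_cluster_ge.
move=> x _; rewrite lee_fin indicE ler_nat.
case: (leqP c _) => //= cK; rewrite mem_set//.
apply: (@card_le_trans _ _ _ (cluster (keep_below (opn x) N) o)).
  by apply/card_ge_csize => //; exact: finite_cluster_below.
by apply: subset_card_le; apply: cluster_mono; exact: keep_below_sub.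
Qed.

Variables (n L : nat) (w : edge G -> R) (W2 l : R).
Hypotheses (n0 : (0 < n)%N) (l0 : 0 < l) (w0 : forall e, 0 <= w e).
Hypothesis W2P : forall v (t : seq (edge G)), uniq t ->
  \sum_(e <- t) (incidence e v)%:R * w e ^+ 2 <= W2.

Local Notation EX := (odds_expectation p U).

(** The error term depends neither on [N] nor on [r]: the first permits the limit over truncations,
    the second the later supremum over [r]. *)
Lemma share_balance (r : seq (edge G)) : uniq r ->
  (\sum_(e <- r) (w e)%:E * EX true e (share n L e o) <=
   \sum_(e <- r) (w e)%:E * EX false e (share n L e o) +
   (l / 2 * (W2 * \sum_(1 <= c < L.+1) budget R n L c * tl c) +
    (\sum_(1 <= c < n.+1) dual_budget R n c * tl c) / (2 * l))%:E)%E.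
Proof.
move=> ur.
have W20 : 0 <= W2 by have := W2P o (isT : uniq [::]); rewrite big_nil.
set C := _ + _ / _.
have cvgEX sg : (\sum_(e <- r) (w e)%:E *
      EX sg e (fun S => share n L e o (keep_below S N)))%E @[N --> \oo] -->
    (\sum_(e <- r) (w e)%:E * EX sg e (share n L e o))%E.
  apply: cvg_nnesum => e _.
    near=> N; rewrite mule_ge0// ?lee_fin//; apply: odds_expectation_ge0 => S.
    exact: share_ge0.
  apply: cvgeZl => //.
  apply: (odds_expectation_below_cvg perc (B := 1)); first exact: stable_share.
  by move=> S; rewrite share_ge0 share_le1.
have fin sg : (\sum_(e <- r) (w e)%:E * EX sg e (share n L e o))%E \is a fin_num.
  rewrite sum_fin_num; apply/allP => _ /mapP[e _ ->].
  rewrite /= fin_numM//; apply: (odds_expectation_fin_num perc sg e (B := 1)).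
    exact: stable_share.
  by move=> S; rewrite share_ge0 share_le1.
apply: (lee_cvg_to (cvgEX true)).
  apply: cvgeD (cvgEX false) (cvg_cst C%:E).
  by rewrite fin_num_adde_defl.
near=> N.
have rN : {subset r <= edges_below G N} by near: N; exact: near_sub_edges_below.
have uN := edges_below_uniq G N.
pose m sg e x := bexp (envp (p x)) (edges_below G N)
  (fun S => odds sg `[<S e>] (envp (p x) e) * share n L e o S).
have m0 sg e x : 0 <= m sg e x.
  by apply: bexp_ge0 => [f|S]; [exact: envp01|rewrite mulr_ge0 ?odds_ge0 ?share_ge0].
have mm sg e : measurable_fun setT (m sg e).
  apply: (measurableT_comp (f := fun y => bexp (envp y) (edges_below G N)
    (fun S => odds sg `[<S e>] (envp y e) * share n L e o S))) => //.
  by apply: measurable_bexp => S; apply: measurable_funM => //; exact: measurable_odds.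
have intm sg : (\sum_(e <- r) (w e)%:E *
      EX sg e (fun S => share n L e o (keep_below S N)) =
    \int[P]_x (\sum_(e <- r) w e * m sg e x)%:E)%E.
  under [RHS]eq_integral do rewrite -sumEFin.
  rewrite ge0_integral_sum//; last 2 first.
  - by move=> e; apply/measurable_EFinP; exact: measurable_funM.
  - by move=> e x _; rewrite lee_fin mulr_ge0.
  apply: eq_big_seq => e er.
  rewrite /odds_expectation.
  rewrite (edge_odds_sampling perc sg (f := share n L e o) _ uN (rN _ er)); last first.
    by move=> S; exact: share_ge0.
  rewrite -ge0_integralZl_EFin//; first by move=> x _; rewrite lee_fin m0.
  by apply/measurable_EFinP; exact: mm.
pose H M a x := bexp (envp (p x)) (edges_below G N)
  (fun S => layers M a (csize (cluster S o))).
have H0 M a x : (forall c, 0 <= a c) -> 0 <= H M a x.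
  by move=> a0; apply: bexp_ge0 => [f|S]; [exact: envp01|exact: layers_ge0].
have mH M a : measurable_fun setT (H M a).
  apply: (measurableT_comp (f := fun y => bexp (envp y) (edges_below G N)
    (fun S => layers M a (csize (cluster S o))))) => //.
  exact: (measurable_bexp _ (F := fun y S => layers M a (csize (cluster S o)))).
have intH M a : (forall c, 0 <= a c) ->
    (\int[P]_x (H M a x)%:E <= (\sum_(1 <= c < M.+1) a c * tl c)%:E)%E.
  move=> a0; apply: le_trans (layers_expectation M N a0).
  rewrite (sampling perc (F := fun _ S => layers M a (csize (cluster S o))))//.
  by move=> _ S; exact: layers_ge0.
have sum0 sg x : 0 <= \sum_(e <- r) w e * m sg e x.
  by apply: sumr_ge0 => e _; rewrite mulr_ge0.
have msum sg : measurable_fun setT (fun x => \sum_(e <- r) w e * m sg e x).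
  by apply: measurable_sum => e; exact: measurable_funM.
have b0 := budget_ge0 R n L; have d0 := dual_budget_ge0 R n.
rewrite !intm.
apply: (@le_trans _ _ (\int[P]_x ((\sum_(e <- r) w e * m false e x)%:E +
   ((l / 2 * W2)%:E * (H L (budget R n L) x)%:E +
    ((2 * l)^-1)%:E * (H n (dual_budget R n) x)%:E)))%E).
  apply: ge0_le_integral => //.
  - by move=> x _; rewrite lee_fin.
  - by apply/measurable_EFinP.
  - apply/measurable_EFinP; apply: measurable_funD => //.
    by apply: measurable_funD; exact: measurable_funM.
  move=> x _; rewrite -!EFinM -!EFinD lee_fin.
  have tb := truncated_balance (envp01 (p x)) L n0 l0 W2P o uN ur rN.
  apply: le_trans tb _.
  by rewrite le_eqVlt; apply/orP; left; apply/eqP; rewrite /m /H; ring.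
have c1 : 0 <= l / 2 * W2 by rewrite mulr_ge0// divr_ge0// ltW.
have c2 : 0 <= (2 * l)^-1 by rewrite invr_ge0 mulr_ge0// ltW.
rewrite ge0_integralD//; last 4 first.
- by move=> x _; rewrite lee_fin.
- by apply/measurable_EFinP.
- by move=> x _; rewrite -!EFinM -EFinD lee_fin addr_ge0// mulr_ge0// H0.
- by apply/measurable_EFinP; apply: measurable_funD; exact: measurable_funM.
rewrite leeD2l//.
rewrite ge0_integralD//; last 4 first.
- by move=> x _; rewrite -EFinM lee_fin mulr_ge0// H0.
- by apply/measurable_EFinP; exact: measurable_funM.
- by move=> x _; rewrite -EFinM lee_fin mulr_ge0// H0.
- by apply/measurable_EFinP; exact: measurable_funM.
rewrite /C EFinD; apply: leeD.
  rewrite ge0_integralZl_EFin//; last 2 first.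
  - by move=> x _; rewrite lee_fin H0.
  - by apply/measurable_EFinP.
  by rewrite mulrA [leRHS]EFinM lee_wpmul2l ?lee_fin// intH.
rewrite ge0_integralZl_EFin//; last 2 first.
- by move=> x _; rewrite lee_fin H0.
- by apply/measurable_EFinP.
by rewrite [X in (_ <= X%:E)%E]mulrC [leRHS]EFinM lee_wpmul2l ?lee_fin// intH.
Unshelve. all: by end_near. Qed.

End Balance.

(** * Mass transport *)

Section CountableSums.
Variable R : realType.
Implicit Types T : countType.
Local Open Scope ereal_scope.

Definition along_pickle T (a : T -> \bar R) (i : nat) : \bar R :=
  if @pickle_inv T i is Some t then a t else 0.

Lemma esum_count T (a : T -> \bar R) : (forall t, 0 <= a t) ->
  \esum_(t in [set: T]) a t = \sum_(i <oo) along_pickle a i.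
Proof.
move=> a0; rewrite nneseries_esumT; last first.
  by move=> i; rewrite /along_pickle; case: pickle_inv.
rewrite (_ : \esum_(i in [set: nat]) along_pickle a i =
    \esum_(i in range (@choice.pickle T)) along_pickle a i); last first.
  rewrite [RHS]esum_mkcond; apply: eq_esum => i _.
  case: ifPn => //; rewrite notin_setE => ni; rewrite /along_pickle.
  case: pickle_inv (@pickle_invK T i) => //= t ti; exfalso; apply: ni.
  by exists t.
rewrite (@reindex_esum _ _ _ [set: T] _ (@choice.pickle T)).
  by apply: eq_esum => t _; rewrite /along_pickle pickleK_inv.
apply/inj_bij => t u _ _ tu; have := pickleK_inv t; rewrite tu pickleK_inv.
by case.
Qed.

Lemma esumZ T (c : R) (a : T -> \bar R) : (0 <= c)%R -> (forall t, 0 <= a t) ->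
  \esum_(t in [set: T]) (c%:E * a t) = c%:E * \esum_(t in [set: T]) a t.
Proof.
move=> c0 a0; rewrite !esum_count//; last by move=> t; rewrite mule_ge0// lee_fin.
rewrite -nneseriesZl; last by move=> i _; rewrite /along_pickle; case: pickle_inv.
apply: eq_eseriesr => i _; rewrite /along_pickle; case: pickle_inv => //.
by rewrite mule0.
Qed.

Lemma esum_swap T1 T2 (a : T1 -> T2 -> \bar R) : (forall i j, 0 <= a i j) ->
  \esum_(i in [set: T1]) \esum_(j in [set: T2]) a i j =
  \esum_(j in [set: T2]) \esum_(i in [set: T1]) a i j.
Proof.
move=> a0; rewrite !esum_esum//.
rewrite (@reindex_esum _ _ _ ([set: T2] `*`` (fun=> [set: T1])) _
  (fun k : T2 * T1 => (k.2, k.1))); first exact: eq_esum.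
split=> [//|[i j] [i' j'] _ _ [-> ->]//|[i j] _]; by exists (j, i).
Qed.

Lemma integral_esum d (Om : measurableType d) (P : {measure set Om -> \bar R})
    T (f : T -> Om -> \bar R) :
  (forall t, measurable_fun setT (f t)) -> (forall t x, 0 <= f t x) ->
  \int[P]_x (\esum_(t in [set: T]) f t x) = \esum_(t in [set: T]) \int[P]_x f t x.
Proof.
move=> mf f0; rewrite esum_count; last by move=> t; exact: integral_ge0.
under eq_integral do rewrite esum_count//.
rewrite integral_nneseries//.
- apply: eq_eseriesr => i _; rewrite /along_pickle; case: pickle_inv => //.
  by rewrite integral0.
- by move=> i; rewrite /along_pickle; case: pickle_inv.
- by move=> i x _; rewrite /along_pickle; case: pickle_inv.
Qed.

Lemma esum_pick (T : choiceType) (t : T) (c : \bar R) : 0 <= c ->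
  \esum_(u in [set: T]) (if t == u then c else 0) = c.
Proof.
move=> c0; rewrite -[RHS](@esum_set1 R T t (fun=> c) c0) [RHS]esum_mkcond.
apply: eq_esum => u _; rewrite (_ : (u \in [set t]) = (t == u))//.
by apply/idP/eqP; rewrite inE.
Qed.

End CountableSums.

Section IncidenceSums.
Variables (R : realType) (G : weighted_graph R).
Local Open Scope ereal_scope.

Lemma incidenceE (c : R) (e : edge G) v : ((incidence e v)%:R * c)%:E =
  (if (ends e).1 == v then c%:E else 0) + (if (ends e).2 == v then c%:E else 0).
Proof.
by rewrite /incidence; do 2 case: eqP => _; rewrite ?add0e ?adde0 -?EFinD;
  congr EFin; rewrite ?add0n ?addn0 /=; ring.
Qed.

Lemma esum_incidence (c : R) (e : edge G) : (0 <= c)%R ->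
  \esum_(v in [set: vertex G]) ((incidence e v)%:R * c)%:E = (2 * c)%:E.
Proof.
move=> c0; under eq_esum do rewrite incidenceE.
rewrite esumD; try by move=> v _; case: ifP => //; rewrite lee_fin.
by rewrite !esum_pick ?lee_fin// -EFinD; congr EFin; ring.
Qed.

Lemma esum_oriented_edges (v : vertex G) (h : edge G -> R) :
  (forall e, (0 <= h e)%R) ->
  \esum_(a in oriented_edges_from v) (h a.1)%:E =
  \esum_(e in [set: edge G]) ((incidence e v)%:R * h e)%:E.
Proof.
move=> h0.
pose J (e : edge G) : set bool := [set b | endpoint (@ends R G) (e, b) = v].
have -> : oriented_edges_from v = [set: edge G] `*`` J.
  by apply/seteqP; split=> -[e b] //= [].
rewrite -(esum_esum (a := fun e b => (h e)%:E)); last by move=> e b _ _; rewrite lee_fin.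
apply: eq_esum => e _; rewrite incidenceE esum_mkcond.
rewrite (esumID [set true]); last by move=> b _; case: ifP => //; rewrite lee_fin.
rewrite setTI (_ : [set: bool] `&` ~` [set true] = [set false]); last first.
  apply/seteqP; split=> [b [_ nb]|_ ->]; last by split.
  by case: b nb => // nb; exfalso; apply: nb.
rewrite !esum_set1; try by case: ifP => //; rewrite lee_fin.
have JE b : (b \in J e) = (endpoint (@ends R G) (e, b) == v).
  by apply/idP/eqP; rewrite inE.
by rewrite !JE.
Qed.

End IncidenceSums.

Section ShareSum.
Variables (R : realType) (G : weighted_graph R) (n L : nat).
Implicit Types (S : set (edge G)) (e : edge G) (K : set (vertex G)).
Local Open Scope ereal_scope.

Lemma esum_capped K (c : R) : (0 <= c)%R ->
  \esum_(v in K) (c * (capped R n L (csize K) / (csize K)%:R))%:E =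
  (c * capped R n L (csize K))%:E.
Proof.
move=> c0; have [K0|K0] := posnP (csize K).
  by rewrite K0 esum1 => [|v _]; rewrite /capped /= ?mul0r mulr0.
have Kfin := csize_finite K0.
rewrite esum_fset//; last first.
  by move=> v _; rewrite lee_fin mulr_ge0// divr_ge0// capped_ge0.
rewrite fsbig_finite//= sumEFin big_const_seq count_predT iter_addr_0.
congr EFin; rewrite -/(csize K) -mulr_natr; field.
by rewrite pnatr_eq0 -lt0n.
Qed.

(** Each of the [k] vertices of a touched cluster receives [f k / k]. *)
Lemma esum_share e S (c : R) : (0 <= c)%R ->
  \esum_(v in [set: vertex G]) (c * share n L e v S)%:E =
  (c * cluster_weight n L e S)%:E.
Proof.
move=> c0; pose K1 := cluster S (ends e).1; pose K2 := cluster S (ends e).2.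
(* This coefficient vanishes when both endpoints share a cluster, which is then counted only
   once. *)
pose nK := (c * `[<~ cluster S (ends e).1 (ends e).2>]%:R)%R.
have nK0 : (0 <= nK)%R by rewrite mulr_ge0.
pose h (K : set (vertex G)) (a : R) : \bar R :=
  (a * (capped R n L (csize K) / (csize K)%:R))%:E.
have h0 K a : (0 <= a)%R -> 0 <= h K a.
  by move=> a0; rewrite lee_fin mulr_ge0// divr_ge0// capped_ge0.
transitivity (\esum_(v in [set: vertex G])
    ((if v \in K1 then h K1 c else 0) + (if v \in K2 then h K2 nK else 0))).
  apply: eq_esum => v _; rewrite /share.
  have [v1|v1] := boolP (v \in K1).
    rewrite inE in v1; rewrite -(cluster_eq v1) -/K1 asboolT ?mulr1; last first.
      by left; exact: cluster_refl.
    case: ifPn => [|_]; last by rewrite adde0.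
    rewrite inE => v2; rewrite /h /nK asboolF ?mulr0 ?mul0r ?adde0// => nc; apply: nc.
    exact: cluster_trans v1 (cluster_sym v2).
  rewrite notin_setE in v1; case: ifPn => [|v2]; last first.
    rewrite notin_setE in v2; rewrite adde0 asboolF ?mulr0// => -[] /cluster_sym.
      exact: v1.
    exact: v2.
  rewrite inE => v2; rewrite add0e -(cluster_eq v2) -/K2 asboolT; last first.
    by right; exact: cluster_refl.
  rewrite /h /nK asboolT ?mulr1// => c12; apply: v1; exact: cluster_trans c12 v2.
rewrite esumD; try by move=> v _; case: ifP => // _; exact: h0.
rewrite -!esum_mkcond /h !esum_capped// -EFinD; congr EFin.
rewrite /cluster_weight -/K1 -/K2 /nK; ring.
Qed.

End ShareSum.

Section MassTransport.
Variables (R : realType) (G : weighted_graph R).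
Variables (mu : probability (environment G) R).
Context d (Om : measurableType d) (P : probability Om R).
Variables (p : {RV P >-> environment G}) (U : edge G -> {RV P >-> R}).
Hypothesis perc : percolation_in_environment p U mu.
Variables (Gamma : set (graph_map G)).
Hypotheses (Gamma_sub : subgroup_of_Aut Gamma).
Hypotheses (Gamma_unimod : unimodular Gamma) (mu_inv : invariant_law Gamma mu).
Variables (n L : nat).
Hypothesis n0 : (0 < n)%N.
Implicit Types (e : edge G) (u v : vertex G) (sg : bool).

Local Notation EX := (odds_expectation p U).

Let GammaAut : Gamma `<=` @Aut R G. Proof. by case: Gamma_sub. Qed.

Definition share_expectation sg e v : \bar R := EX sg e (share n L e v).
Definition weight_expectation sg e : \bar R := EX sg e (cluster_weight n L e).

Lemma share01 e v S : 0 <= share n L e v S <= (1 : R).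
Proof. by rewrite share_ge0 share_le1. Qed.

Lemma cluster_weight02 e S : 0 <= cluster_weight n L e S <= (2 : R).
Proof. by rewrite cluster_weight_ge0 cluster_weight_le2. Qed.

Lemma share_expectation_ge0 sg e v : (0 <= share_expectation sg e v)%E.
Proof. by apply: odds_expectation_ge0 => S; exact: share_ge0. Qed.

Lemma weight_expectation_ge0 sg e : (0 <= weight_expectation sg e)%E.
Proof. by apply: odds_expectation_ge0 => S; exact: cluster_weight_ge0. Qed.

Lemma weight_expectation_le2 sg e : (weight_expectation sg e <= 2%:E)%E.
Proof.
exact: (odds_expectation_le perc sg e (stable_cluster_weight n L e) (cluster_weight02 e)).
Qed.

Lemma weight_expectation_fin_num sg e : weight_expectation sg e \is a fin_num.
Proof.
exact: (odds_expectation_fin_num perc sg e (stable_cluster_weight n L e) (cluster_weight02 e)).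
Qed.

Lemma esum_share_expectation sg e :
  (\esum_(v in [set: vertex G]) share_expectation sg e v = weight_expectation sg e)%E.
Proof.
rewrite /weight_expectation /odds_expectation.
under eq_integral do rewrite -esum_share ?edge_odds_ge0//.
rewrite integral_esum// => v.
  apply/measurable_EFinP; apply: measurable_funM; first exact: measurable_edge_odds.
  exact: measurable_stable (stable_share n L e v).
by move=> x; rewrite lee_fin mulr_ge0 ?edge_odds_ge0 ?share_ge0.
Qed.

Lemma bij_on_vertex gam : Gamma gam -> set_bij setT setT (on_vertex gam).
Proof. by move=> /GammaAut[? _ _ _]; rewrite setTT_bijective. Qed.

Lemma bij_on_edge gam : Gamma gam -> set_bij setT setT (on_edge gam).
Proof. by move=> /GammaAut[_ ? _ _]; rewrite setTT_bijective. Qed.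

Lemma share_expectation_on gam sg e v : Gamma gam ->
  share_expectation sg (on_edge gam e) (on_vertex gam v) = share_expectation sg e v.
Proof.
move=> gamP; rewrite /share_expectation -(odds_expectation_on perc GammaAut mu_inv gamP sg e
  (stable_share n L e v) (share01 e v)).
by congr odds_expectation; apply/funext => S; rewrite share_on//; exact: GammaAut.
Qed.

Lemma weight_expectation_on gam sg e : Gamma gam ->
  weight_expectation sg (on_edge gam e) = weight_expectation sg e.
Proof.
move=> gamP; rewrite -!esum_share_expectation (reindex_esum _ _ _ _ (bij_on_vertex gamP)).
by apply: eq_esum => v _; exact: share_expectation_on.
Qed.

Variable w : edge G -> R.
Hypotheses (w0 : forall e, 0 <= w e)
  (w_on : forall gam e, Gamma gam -> w (on_edge gam e) = w e).

(** Each end [u] of an edge sends mass to the vertices of the clusters which that edge touches. *)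
Definition transport sg u v : \bar R :=
  (\esum_(e in [set: edge G]) ((incidence e u)%:R * w e)%:E * share_expectation sg e v)%E.

Lemma transport_on gam sg u v : Gamma gam ->
  transport sg (on_vertex gam u) (on_vertex gam v) = transport sg u v.
Proof.
move=> gamP; rewrite /transport (reindex_esum _ _ _ _ (bij_on_edge gamP)).
apply: eq_esum => e _; rewrite share_expectation_on// w_on// incidence_on//; exact: GammaAut.
Qed.

Lemma transport_ge0 sg u v : (0 <= transport sg u v)%E.
Proof.
by apply: esum_ge0 => e _; rewrite mule_ge0 ?share_expectation_ge0// lee_fin mulr_ge0.
Qed.

(** Mass leaving [o] sums the shares of an edge to its full cluster weight. Mass arriving at [o]
    counts each edge once per orientation, whence the factor 2. *)
Lemma mass_transport sg o :
  (\esum_(e in [set: edge G]) ((incidence e o)%:R * w e)%:E * weight_expectation sg e =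
   2%:E * \esum_(e in [set: edge G]) (w e)%:E * share_expectation sg e o)%E.
Proof.
have iw0 e v : (0 <= ((incidence e v)%:R * w e)%:E)%E by rewrite lee_fin mulr_ge0.
transitivity (\esum_(v in [set: vertex G]) transport sg o v)%E.
  rewrite /transport esum_swap; last by move=> v e; rewrite mule_ge0 ?share_expectation_ge0.
  apply: eq_esum => e _; rewrite esumZ ?esum_share_expectation// => [|v]; last first.
    exact: share_expectation_ge0.
  by rewrite mulr_ge0.
rewrite (Gamma_unimod o (transport_ge0 sg)) => [|gam gamP u v]; last exact: transport_on.
rewrite /transport esum_swap; last by move=> v e; rewrite mule_ge0 ?share_expectation_ge0.
rewrite -esumZ//; last by move=> e; rewrite mule_ge0 ?share_expectation_ge0// lee_fin.
apply: eq_esum => e _.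
have Yfin : share_expectation sg e o \is a fin_num.
  exact: (odds_expectation_fin_num perc sg e (stable_share n L e o) (share01 e o)).
under eq_esum do rewrite muleC.
rewrite -(fineK Yfin) esumZ//; last by rewrite fine_ge0 ?share_expectation_ge0.
by rewrite esum_incidence// muleA -!EFinM; congr EFin; ring.
Qed.

End MassTransport.

Lemma esum_le_seq (R : realType) (T : choiceType) (I : set T) (a : T -> \bar R)
    (x : \bar R) :
  (forall r : seq T, uniq r -> {in r, forall t, I t} -> (\sum_(t <- r) a t <= x)%E) ->
  (\esum_(t in I) a t <= x)%E.
Proof.
move=> h; apply: ge_ereal_sup => _ [X [finX XI] <-].
rewrite fsbig_finite//=; apply: h => [|t]; first exact: fset_uniq.
by rewrite in_fset_set// inE => /XI.
Qed.

Lemma seq_le_esum (R : realType) (T : choiceType) (I : set T) (a : T -> \bar R)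
    (r : seq T) : uniq r -> {in r, forall t, I t} ->
  (\sum_(t <- r) a t <= \esum_(t in I) a t)%E.
Proof.
move=> ur rI; apply: esum_ge; exists [set` r]; first by split=> // t /rI.
by rewrite -fsbig_seq.
Qed.

(** * Bound on the energy *)

Section Energy.
Variables (R : realType) (G : weighted_graph R).
Variables (mu : probability (environment G) R).
Context d (Om : measurableType d) (P : probability Om R).
Variables (p : {RV P >-> environment G}) (U : edge G -> {RV P >-> R}).
Hypothesis perc : percolation_in_environment p U mu.
Variables (Gamma : set (graph_map G)).
Hypotheses (Gamma_sub : subgroup_of_Aut Gamma) (Gamma_trans : acts_transitively Gamma).
Hypotheses (Gamma_unimod : unimodular Gamma) (mu_inv : invariant_law Gamma mu).
Variables (n L : nat).
Hypothesis n0 : (0 < n)%N.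
Implicit Types (e : edge G) (u v : vertex G) (sg : bool).

Local Notation EX := (odds_expectation p U).
Local Notation opn := (open_edges p U).
Local Notation sharex := (share_expectation p U n L).
Local Notation weightx := (weight_expectation p U n L).

Let GammaAut : Gamma `<=` @Aut R G. Proof. by case: Gamma_sub. Qed.

Lemma stable_indicator (A : set (edge G) -> Prop) :
  stable (fun S => `[<A S>]) -> stable (fun S => `[<A S>]%:R : R).
Proof. by move=> st S; apply: filterS (st S) => N ->. Qed.

Lemma insertion_expectation e :
  (EX true e (fun S => `[<two_clusters_le n L e S>]%:R) + weightx false e <= weightx true e)%E.
Proof.
pose T S : R := `[<two_clusters_le n L e S>]%:R.
have T01 S : 0 <= T S <= 1 by rewrite /T; case: asboolP; rewrite ?lexx ?ler01.
have Tst : stable T by apply: stable_indicator; exact: stable_two_clusters_le.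
have W02 := @cluster_weight02 R G n L n0 e.
have Wst := @stable_cluster_weight R G n L e.
have T0 S : 0 <= T S by case/andP: (T01 S).
have W0 S : 0 <= cluster_weight n L e S by case/andP: (W02 S).
apply: (lee_cvg_to _ (odds_expectation_below_cvg perc (sg := true) (e := e) Wst W02)).
  apply: cvgeD (odds_expectation_below_cvg perc (sg := true) (e := e) Tst T01)
    (odds_expectation_below_cvg perc (sg := false) (e := e) Wst W02).
  rewrite fin_num_adde_defl//.
  exact: (odds_expectation_fin_num perc false e Wst W02).
near=> N; have eN : e \in edges_below G N by near: N; exact: near_edges_below.
have uN := edges_below_uniq G N.
rewrite /odds_expectation !(edge_odds_sampling perc _ _ uN eN)//.
have ge0 sg (f : set (edge G) -> R) x : (forall S, 0 <= f S) ->
    0 <= bexp (envp (p x)) (edges_below G N)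
      (fun S => odds sg `[<S e>] (envp (p x) e) * f S).
  by move=> f0; apply: bexp_ge0 => [f'|S]; [exact: envp01|rewrite mulr_ge0// odds_ge0].
have mb sg (f : set (edge G) -> R) : measurable_fun setT
    (fun x => bexp (envp (p x)) (edges_below G N)
      (fun S => odds sg `[<S e>] (envp (p x) e) * f S)).
  apply: (measurableT_comp (f := fun y => bexp (envp y) (edges_below G N)
    (fun S => odds sg `[<S e>] (envp y e) * f S))) => //.
  by apply: measurable_bexp => S; apply: measurable_funM => //; exact: measurable_odds.
rewrite -ge0_integralD//; last 4 first.
- by move=> x _; rewrite lee_fin ge0.
- exact/measurable_EFinP/mb.
- by move=> x _; rewrite lee_fin ge0.
- exact/measurable_EFinP/mb.
apply: ge0_le_integral => //.
- by move=> x _; rewrite -EFinD lee_fin addr_ge0// ge0.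
- by apply/measurable_EFinP; apply: measurable_funD; exact: mb.
- exact/measurable_EFinP/mb.
move=> x _; rewrite -EFinD lee_fin.
have ib := insertion_bound (envp01 (p x)) L n0 uN eN.
exact: ib.
Unshelve. all: by end_near. Qed.

Definition gain e : R := fine (weightx true e) - fine (weightx false e).

Let weightx_fin sg e : weightx sg e \is a fin_num.
Proof. exact: (weight_expectation_fin_num perc L n0). Qed.

Lemma insertion_le_gain e :
  (EX true e (fun S => `[<two_clusters_le n L e S>]%:R) <= (gain e)%:E)%E.
Proof.
by rewrite EFinB !fineK ?weightx_fin// leeBrDr ?weightx_fin// insertion_expectation.
Qed.

Lemma gain_ge0 e : 0 <= gain e.
Proof.
rewrite -lee_fin; apply: le_trans (insertion_le_gain e).
by apply: odds_expectation_ge0 => S.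
Qed.

Lemma gain_le2 e : gain e <= 2.
Proof.
apply: (@le_trans _ _ (fine (weightx true e))).
  by rewrite gerBl fine_ge0// weight_expectation_ge0.
by rewrite -lee_fin fineK ?weightx_fin//; exact: (weight_expectation_le2 perc L n0).
Qed.

Lemma gain_on gam e : Gamma gam -> gain (on_edge gam e) = gain e.
Proof. by move=> gamP; rewrite /gain !(weight_expectation_on perc Gamma_sub mu_inv L n0). Qed.

Variables (o : vertex G) (tl : nat -> R).
Hypothesis tail : forall c : nat, (1 <= c)%N ->
  (P (cluster_ge p U o c) <= (tl c)%:E)%E.

Let alpha : R := \sum_(1 <= c < L.+1) budget R n L c * tl c.
Let beta : R := \sum_(1 <= c < n.+1) dual_budget R n c * tl c.

Section Weight.
Variable w : edge G -> R.
Hypotheses (w0 : forall e, 0 <= w e) (w_gain : forall e, w e <= gain e)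
  (w_on : forall gam e, Gamma gam -> w (on_edge gam e) = w e)
  (w_sum : (\esum_(e in [set: edge G]) ((incidence e o)%:R * w e)%:E < +oo)%E).

Let energy : \bar R := (\esum_(e in [set: edge G]) ((incidence e o)%:R * w e ^+ 2)%:E)%E.

Lemma energy_fin : energy \is a fin_num.
Proof.
rewrite ge0_fin_numE; last first.
  by apply: esum_ge0 => e _; rewrite lee_fin mulr_ge0// sqr_ge0.
apply: (@le_lt_trans _ _
    (2%:E * \esum_(e in [set: edge G]) ((incidence e o)%:R * w e)%:E)%E).
  rewrite -esumZ//; last by move=> e; rewrite lee_fin mulr_ge0.
  apply: le_esum => e _; rewrite -EFinM lee_fin [leRHS]mulrCA ler_wpM2l// expr2.
  by rewrite ler_wpM2r//; exact: le_trans (w_gain e) (gain_le2 e).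
by rewrite lte_mul_pinfty// lee_fin.
Qed.

(** Transitivity gives every vertex the energy of [o], so the exploration may charge the same budget
    at each vertex it discovers. *)
Lemma vertex_energy_le v (t : seq (edge G)) : uniq t ->
  \sum_(e <- t) (incidence e v)%:R * w e ^+ 2 <= fine energy.
Proof.
have Efin := energy_fin.
move=> ut; rewrite -lee_fin fineK// -sumEFin.
have [gam gamP gamv] := Gamma_trans o v.
have -> : energy = (\esum_(e in [set: edge G]) ((incidence e v)%:R * w e ^+ 2)%:E)%E.
  rewrite (reindex_esum _ _ _ _ (bij_on_edge Gamma_sub gamP)).
  apply: eq_esum => e _; rewrite w_on// -gamv incidence_on//; exact: GammaAut.
exact: seq_le_esum.
Qed.

(** From [w <= gain], the energy plus the weighted negative parts is at most the weighted positive
    parts. Mass transport rewrites both as sums seen from [o], where the exploration compares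
    them. *)
Lemma energy_le (l : R) : 0 < l ->
  fine energy <= l * (fine energy * alpha) + beta / l.
Proof.
have Efin := energy_fin.
move=> l0; pose C : R := l / 2 * (fine energy * alpha) + beta / (2 * l).
have -> : l * (fine energy * alpha) + beta / l = 2 * C.
  by rewrite /C; field; rewrite gt_eqF.
have bal : (\esum_(e in [set: edge G]) (w e)%:E * sharex true e o <=
    (\esum_(e in [set: edge G]) (w e)%:E * sharex false e o) + C%:E)%E.
  apply: esum_le_seq => r ur _.
  have sb := share_balance perc tail L n0 l0 w0 vertex_energy_le ur.
  apply: le_trans sb _.
  by rewrite leeD2r//; exact: seq_le_esum.
have mt := mass_transport perc Gamma_sub Gamma_unimod mu_inv L n0 w0 w_on _ o.
pose M sg : \bar R :=
  (\esum_(e in [set: edge G]) ((incidence e o)%:R * w e)%:E * weightx sg e)%E.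
have Mfin : M false \is a fin_num.
  rewrite ge0_fin_numE; last first.
    by apply: esum_ge0 => e _; rewrite mule_ge0 ?weight_expectation_ge0// lee_fin mulr_ge0.
  apply: (@le_lt_trans _ _
      (2%:E * \esum_(e in [set: edge G]) ((incidence e o)%:R * w e)%:E)%E).
    rewrite -esumZ//; last by move=> e; rewrite lee_fin mulr_ge0.
    apply: le_esum => e _; rewrite muleC lee_wpmul2r ?lee_fin ?mulr_ge0//.
    exact: (weight_expectation_le2 perc L n0).
  by rewrite lte_mul_pinfty// lee_fin.
(* The negative parts are added to both sides, which loses nothing because they are finite. *)
rewrite -lee_fin fineK// -(leeD2rE _ _ Mfin).
apply: (@le_trans _ _ (M true)).
  rewrite /energy /M -esumD; last 2 first.
  - by move=> e _; rewrite lee_fin mulr_ge0// sqr_ge0.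
  - by move=> e _; rewrite mule_ge0 ?weight_expectation_ge0// lee_fin mulr_ge0.
  apply: le_esum => e _; rewrite -(fineK (weightx_fin true e)) -(fineK (weightx_fin false e)).
  rewrite -!EFinM -EFinD lee_fin expr2 mulrA -mulrDr ler_wpM2l ?mulr_ge0//.
  by rewrite -lerBrDr; exact: w_gain.
rewrite /M !mt addeC EFinM -muleDr//; first by rewrite lee_wpmul2l// lee_fin.
by rewrite fin_num_adde_defl.
Qed.

End Weight.

(* The energy of [gain] itself is not known to be finite beforehand, whence the
   truncation by the summable weights of the graph. *)
Lemma gain_energy_le (k a b : R) : 0 <= k -> 0 < a -> alpha <= a -> beta <= b ->
  (\esum_(e in [set: edge G])
     ((incidence e o)%:R * (gain e * Num.min 1 (k * weight e)) ^+ 2)%:E <=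
   (4 * a * b)%:E)%E.
Proof.
move=> k0 a0 alpha_a beta_b.
pose w e := gain e * Num.min 1 (k * weight e).
have m01 e : 0 <= Num.min 1 (k * weight e) <= 1.
  by rewrite ge_min lexx /= le_min ler01 /= mulr_ge0// ltW// weight_gt0.
have w0 e : 0 <= w e by case/andP: (m01 e) => m0 _; rewrite mulr_ge0// gain_ge0.
have w_gain e : w e <= gain e.
  by case/andP: (m01 e) => _ m1; rewrite ler_piMr// gain_ge0.
have w_on gam e : Gamma gam -> w (on_edge gam e) = w e.
  move=> gamP; rewrite /w gain_on//; case: (GammaAut gamP) => _ _ _ ->//.
have w_sum : (\esum_(e in [set: edge G]) ((incidence e o)%:R * w e)%:E < +oo)%E.
  apply: (@le_lt_trans _ _ ((2 * k)%:E *
      \esum_(e in [set: edge G]) ((incidence e o)%:R * weight e)%:E)%E).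
    rewrite -esumZ ?mulr_ge0//; last first.
      by move=> e; rewrite lee_fin mulr_ge0// ltW// weight_gt0.
    apply: le_esum => e _; rewrite -EFinM lee_fin [leRHS]mulrCA ler_wpM2l// -mulrA.
    case/andP: (m01 e) => m0 _.
    by rewrite ler_pM ?gain_ge0 ?gain_le2// ge_min lexx orbT.
  rewrite lte_mul_pinfty ?lee_fin ?mulr_ge0// -esum_oriented_edges.
    exact: weight_summable.
  by move=> e; rewrite ltW// weight_gt0.
(* With [l = 1 / (2 * a)] the first term is at most half the energy and the second at most
   [2 * a * b], whence [4 * a * b]. *)
have l0 : 0 < (2 * a)^-1 by rewrite invr_gt0 mulr_gt0.
have := energy_le w0 w_gain w_on w_sum l0.
set E := (\esum_(e in _) _)%E.
have E0 : (0 <= E)%E by apply: esum_ge0 => e _; rewrite lee_fin mulr_ge0// sqr_ge0.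
have Efin : E \is a fin_num by exact: (energy_fin w0 w_gain w_sum).
move=> El; rewrite -/E -(fineK Efin) lee_fin.
have F0 : 0 <= fine E by rewrite fine_ge0.
have h1 : (2 * a)^-1 * (fine E * alpha) <= fine E / 2.
  rewrite (_ : fine E / 2 = (2 * a)^-1 * (fine E * a)); last by field; rewrite gt_eqF.
  by rewrite ler_wpM2l ?(ltW l0)// ler_wpM2l.
have h2 : beta / (2 * a)^-1 <= 2 * a * b by rewrite invrK mulrC ler_wpM2l ?mulr_ge0// ltW.
have := le_trans El (lerD h1 h2); lra.
Qed.

End Energy.

(** * Removal of the size cut-off *)

Section Limit.
Variables (R : realType) (G : weighted_graph R).
Variables (mu : probability (environment G) R).
Context d (Om : measurableType d) (P : probability Om R).
Variables (p : {RV P >-> environment G}) (U : edge G -> {RV P >-> R}).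
Hypothesis perc : percolation_in_environment p U mu.
Variables (n : nat).
Implicit Types (e : edge G) (S : set (edge G)).

Local Notation EX := (odds_expectation p U).

(** On the event [e] is closed, since an open edge would join the two clusters; there the positive
    part is exactly the square root in the integrand. *)
Lemma sqrt_odds_expectation e : 'E_P[sqrt_odds_on_event p U e n]%E =
  EX true e (fun S => `[<two_clusters e n S>]%:R).
Proof.
rewrite unlock /odds_expectation; apply: eq_integral => x _; congr EFin.
rewrite /sqrt_odds_on_event indicE.
rewrite (_ : (x \in _) = `[<two_clusters e n (open_edges p U x)>]); last first.
  by apply/idP/asboolP; rewrite inE.
case: asboolP => [[/= K12 _ _ _]|_]; last by rewrite mul0r mulr0.
rewrite mul1r mulr1 /edge_odds -open_edgesE asboolF// => eo.
by apply: K12; exact: cluster_eq (cluster_edge eo).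
Qed.

(** One of the two clusters is finite, so any [L] beyond its size will do. *)
Lemma near_two_clusters_le e S :
  \forall L \near \oo, `[<two_clusters_le n L e S>] = `[<two_clusters e n S>].
Proof.
near=> L; apply/asbool_equiv_eq; split=> [[]//|tc]; split=> //.
have nearL (v : vertex G) : finite_set (cluster S v) ->
    (csize (cluster S v) <= L)%N -> (0 < csize (cluster S v) <= L)%N.
  by move=> Kfin ->; rewrite (csize_gt0 Kfin (cluster_refl S v)).
case: tc => _ _ _ [Kfin|Kfin]; [left|right]; apply: nearL => //; near: L;
  exact: nbhs_infty_ge.
Unshelve. all: by end_near. Qed.

Lemma sqrt_odds_cvg e :
  EX true e (fun S => `[<two_clusters_le n L e S>]%:R) @[L --> \oo] -->
  'E_P[sqrt_odds_on_event p U e n]%E.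
Proof.
rewrite sqrt_odds_expectation.
apply: (odds_expectation_cvg perc (B := 1)
  (fN := fun L S => `[<two_clusters_le n L e S>]%:R)) => [L|L S|S].
- exact: (@measurable_stable _ _ _ _ P p U _
    (stable_indicator (@stable_two_clusters_le R G n L e))).
- by case: asboolP; rewrite ?lexx ?ler01.
- by apply: filterS (near_two_clusters_le e S) => L ->.
Qed.

Lemma sqrt_odds_fin_num e : 'E_P[sqrt_odds_on_event p U e n]%E \is a fin_num.
Proof.
rewrite ge0_fin_numE; last first.
  by rewrite sqrt_odds_expectation; apply: odds_expectation_ge0 => S.
apply: (@le_lt_trans _ _ 1%:E); last exact: ltry.
apply: (cvge_le _ (@sqrt_odds_cvg e)); near=> L.
apply: (odds_expectation_le perc true e (B := 1)).
  by apply: stable_indicator; exact: stable_two_clusters_le.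
by move=> S; case: asboolP; rewrite ?lexx ?ler01.
Unshelve. all: by end_near. Qed.

End Limit.

Unset Implicit Arguments.

Theorem theorem3p1 (R : realType) (G : weighted_graph R) (o : vertex G)
  (Gconn : graph_connected G) (Gtrans : acts_transitively (@Aut R G))
  (Gamma : set (graph_map G))
  (Gamma_sub : subgroup_of_Aut Gamma) (Gamma_closed : closed_in_Aut Gamma)
  (Gamma_trans : acts_transitively Gamma) (Gamma_unimod : unimodular Gamma)
  (mu : probability (environment G) R) (mu_inv : invariant_law Gamma mu)
  (d : measure_display) (Om : measurableType d) (P : probability Om R)
  (p : {RV P >-> environment G}) (U : edge G -> {RV P >-> R})
  (perc : percolation_in_environment p U mu)
  (A theta : R) (theta_ge0 : 0 <= theta) (theta_lt : theta < 1 / 2)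
  (tail : forall n : nat, (1 <= n)%N ->
     (P (cluster_ge p U o n) <= (A * n%:R `^ (- theta))%:E)%E)
  (n : nat) (n_ge1 : (1 <= n)%N) :
  (\esum_(a in oriented_edges_from o)
      ('E_P[sqrt_odds_on_event p U a.1 n]) ^+ 2 <=
   (4 * 10 ^+ 4 * A ^+ 2 / ((1 - 2 * theta) ^+ 2 * n%:R `^ (1 + 2 * theta)))%:E)%E.
Proof.
(* The cluster of [o] contains [o], so the tail assumption at 1 reads [1 <= A]; this makes [a]
   strictly positive. *)
have A_ge1 : 1 <= A.
  have := tail 1%N isT; rewrite powR1 mulr1 (_ : cluster_ge p U o 1 = setT).
    by rewrite probability_setT lee_fin.
  apply/seteqP; split=> // x _; apply/card_geP; exists [fset o]%fset.
    by move=> v /=; rewrite inE => /eqP ->; exact: cluster_refl.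
  by rewrite cardfs1.
have A0 : 0 <= A by exact: le_trans A_ge1.
pose r : R := 1 / 2 - theta.
have r0 : 0 < r by rewrite subr_gt0.
have n0 : 0 < n%:R :> R by rewrite ltr0n.
pose a : R := 2 * (A * (n%:R `^ r / r)).
pose b : R := A * (n%:R `^ r / r) / n%:R ^+ 2.
have a0 : 0 < a.
  by rewrite !mulr_gt0 ?invr_gt0 ?powR_gt0//; exact: lt_le_trans A_ge1.
(* As [r = (1 - 2 * theta) / 2], the left side equals the right side with 32 in place of 40000. *)
have ab : 4 * a * b <=
    4 * 10 ^+ 4 * A ^+ 2 / ((1 - 2 * theta) ^+ 2 * n%:R `^ (1 + 2 * theta)).
  have r2 : 1 - 2 * theta = 2 * r by rewrite /r; field.
  have nn : n%:R `^ (1 + 2 * theta) = n%:R ^+ 2 / (n%:R `^ r * n%:R `^ r).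
    rewrite -powRD ?pnatr_eq0 -?lt0n ?n_ge1 ?implybT// -powR_mulrn//.
    rewrite -powRB ?pnatr_eq0 -?lt0n ?n_ge1 ?implybT//.
    by congr (_ `^ _); rewrite /r; field.
  rewrite r2 nn /a /b; have := powR_gt0 r n0; set z := n%:R `^ r => z0.
  have -> : 4 * (2 * (A * (z / r))) * (A * (z / r) / n%:R ^+ 2) =
    8 * (A ^+ 2 * z ^+ 2 / (r ^+ 2 * n%:R ^+ 2)) by field; rewrite !gt_eqF.
  have -> : 4 * 10 ^+ 4 * A ^+ 2 / ((2 * r) ^+ 2 * (n%:R ^+ 2 / (z * z))) =
    10 ^+ 4 * (A ^+ 2 * z ^+ 2 / (r ^+ 2 * n%:R ^+ 2)) by field; rewrite !gt_eqF.
  rewrite ler_wpM2r//; last by rewrite -natrX ler_nat.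
  by rewrite divr_ge0// mulr_ge0// sqr_ge0.
apply: le_trans (_ : (_ <= (4 * a * b)%:E)%E) _; last by rewrite lee_fin.
apply: esum_le_seq => X uX Xo.
have Xcvg : (\sum_(c <- X)
    (odds_expectation p U true c.1 (fun S => `[<two_clusters_le n L c.1 S>]%:R)) ^+ 2)%E
    @[L --> \oo] --> (\sum_(c <- X) ('E_P[sqrt_odds_on_event p U c.1 n]) ^+ 2)%E.
  apply: cvg_nnesum => c _; first by near=> L; rewrite sqre_ge0.
  apply: cvgeM; try exact: sqrt_odds_cvg perc n c.1.
  by apply: mule_def_fin; exact: sqrt_odds_fin_num perc n c.1.
apply: (cvge_le _ Xcvg); near=> L.
(* This choice makes [k * weight] at least 1 on the finite set [X], so the summable truncation of
   [gain] is invisible there; the bound [4 * a * b] does not depend on [k]. *)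
pose k : R := \sum_(c <- X) (weight c.1)^-1.
have k0 : 0 <= k by apply: sumr_ge0 => c _; rewrite invr_ge0 ltW// weight_gt0.
have := gain_energy_le perc Gamma_sub Gamma_trans Gamma_unimod mu_inv n_ge1
  tail k0 a0 (budget_sum A0 theta_ge0 theta_lt L n_ge1)
  (dual_budget_sum A0 theta_ge0 theta_lt n_ge1).
apply: le_trans; rewrite -esum_oriented_edges; last by move=> e; rewrite sqr_ge0.
apply: le_trans (seq_le_esum _ uX Xo).
rewrite big_seq [leRHS]big_seq; apply: lee_sum => c cX.
have kc : Num.min 1 (k * weight c.1) = 1.
  apply/min_idPl; rewrite -ler_pdivrMr ?weight_gt0// div1r /k (big_rem c)//= lerDl.
  by apply: sumr_ge0 => e _; rewrite invr_ge0 ltW// weight_gt0.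
have gain0 := gain_ge0 perc L n_ge1 c.1.
rewrite kc mulr1 EFin_expe lee_sqr ?lee_fin//.
  exact: (insertion_le_gain perc L n_ge1 c.1).
by apply: odds_expectation_ge0 => S.
Unshelve. all: by end_near. Qed.
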